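(* Let $m\ge1$ and $0\le q\le m$ be integers, let $\mu:=(2^{(q)},1^{(2m+1-2q)},0^{(q)})$, let $I\subset J$ be nonempty subsets of $\{0,\dots,m\}$ with $1\in I\implies0\in I$ and $1\in J\implies0\in J$, and let $w\in W_{J,B_m}\backslash\widetilde W_{B_m}/W_{I,B_m}$. Then $w$ is $\mu$-permissible if and only if $w\equiv t_\mu\bmod W_{\mathrm{aff},B_m}$ and, for one, hence any, representative $\tilde w$ of $w$ in $\widetilde W_{B_m}/W_{I,B_m}$, the vector $\nu_k^{\tilde w}:=\tilde wa_k-a_k$ satisfies (sp1$'$) and (sp2$'$) for all $k\in I$, and (sp3$'$) for all $k\in I\cap\{0,1\}$, where: (sp1$'$) $\nu_k^{\tilde w}+(\nu_k^{\tilde w})^*=\mathbf2$ and $\mathbf0\le\nu_k^{\tilde w}\le\mathbf2$; (sp2$'$) $\#\{j:\nu_k^{\tilde w}(j)=2\}+\frac14\#\{j:\nu_k^{\tilde w}(j)\notin\mathbb Z\}\le q$; (sp3$'$) if $\nu_k^{\tilde w}\in\mathbb Z^{2m+1}$ and $\nu_k^{\tilde w}\not\equiv\mu\bmod Q^\vee_{B_m}$, then there exists $j\in A_k$ with $\nu_k^{\tilde w}(j)=1$.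
   Context: Notation. For $v\in\mathbb R^{n}$, $v(j)$ is the $j$th entry, $v^*(j)=v(n+1-j)$, $\mathbf d=(d,\dots,d)$, $v\ge w$ means entrywise, and $(d^{(i)},e^{(j)},\dots)$ denotes $d$ repeated $i$ times, then $e$ repeated $j$ times, etc. $i^*:=2m+2-i$ for $i\in\{1,\dots,2m+1\}$. Root datum of split $GO_{2m+1}$. $X_*:=\{x\in\mathbb Z^{2m+1}: x_i+x_{i^*}=2x_{m+1}\ \forall i\}$; $Q^\vee_{B_m}:=\{x\in X_*: x_i+x_{i^*}=0\ \forall i,\ x_1+\dots+x_m\text{ even}\}$; $S_{2m+1}^*:=\{\sigma\in S_{2m+1}:\sigma(i^* )=\sigma(i)^*\ \forall i\}$. $\widetilde W_{B_m}:=X_*\rtimes S_{2m+1}^*$ acts on $\mathcal A:=X_*\otimes\mathbb R\subset\mathbb R^{2m+1}$ by affine transformations, $X_*$ by translations ($t_\lambda$) and $S^*_{2m+1}$ by permuting coordinates; $W_{\mathrm{aff},B_m}:=Q^\vee_{B_m}\rtimes S_{2m+1}^*$. The affine root hyperplanes $\{x_i-x_j=d\}$ ($j\ne i,i^*$, $d\in\mathbb Z$) determine facets in $\mathcal A$. The base alcove is $A_{B_m}:=\{x\in\mathcal A: x_1,\,x_{2m+1}-1<x_2<x_3<\dots<x_{m+1}\}$. $a_k:=((-\frac12)^{(k)},0^{(2m+1-2k)},(\frac12)^{(k)})$ for $0\le k\le m$, $a_{0'}:=(-1,0^{(2m-1)},1)$. The minimal facets of $A_{B_m}$ are the lines $a+\mathbb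 R(1,\dots,1)$ for $a$ one of $a_0,a_{0'},a_2,a_3,\dots,a_m$. $A_k:=\{1,\dots,k\}\cup\{2m+2-k,\dots,2m+1\}$. $W_{I,B_m}:=\{w\in W_{\mathrm{aff},B_m}: wa_k=a_k\ \forall k\in I\}$; this is the stabilizer in $W_{\mathrm{aff},B_m}$ of the subfacet $F_I$ of $A_{B_m}$ whose minimal subfacets are the lines through $a_k$ for $k\in I\smallsetminus\{1\}$, together with the line through $a_{0'}$ if $1\in I$. A double coset $w\in W_{J,B_m}\backslash\widetilde W_{B_m}/W_{I,B_m}$ is $\mu$-permissible if $w\equiv t_\mu\bmod W_{\mathrm{aff},B_m}$ and, for one, hence any, representative $\tilde w$, $\tilde wv-v\in\mathrm{Conv}(S_{2m+1}^*\mu)$ for all $v\in F_I$, where $\mathrm{Conv}(S_{2m+1}^*\mu)$ is the convex hull in $\mathcal A$ of the Weyl orbit of $\mu$. *)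

(* Defs.v *)
From HB Require Import structures.
From mathcomp Require Import all_boot all_order all_algebra all_fingroup.
From mathcomp Require Import all_classical all_reals all_analysis.

Set Implicit Arguments.
Unset Strict Implicit.
Unset Printing Implicit Defensive.

Import Order.TTheory GRing.Theory Num.Theory.
Import numFieldNormedType.Exports.

Local Open Scope classical_set_scope.
Local Open Scope ring_scope.

(* Coordinates are indexed from 0: the entry written v(j), 1 <= j <= 2m+1, is
   [v 0 (j-1)], and the involution i |-> i^* = 2m+2-i is [rev_ord]. *)

Section AffinePermutations.
Variable n : nat.

(* [(l, s)] stands for t_l s in Z^n x| S_n. *)
Definition affperm : Type := ('rV[int]_n * {perm 'I_n})%type.
HB.instance Definition _ := Choice.on affperm.

(* Coordinate i of x is moved to position s(i). *)
Definition permv (T : Type) (s : {perm 'I_n}) (x : 'rV[T]_n) : 'rV[T]_n :=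
  col_perm s^-1%g x.

(* The product of permutations in the library is diagrammatic,
   (s * t) i = t (s i), whereas here permutations compose as functions. *)
Definition affperm_mul (x y : affperm) : affperm :=
  (x.1 + permv x.2 y.1, (y.2 * x.2)%g).
Definition affperm_one : affperm := (0, 1%g).
Definition affperm_inv (x : affperm) : affperm :=
  (- permv x.2^-1%g x.1, x.2^-1%g).

Lemma permvM (T : Type) (s t : {perm 'I_n}) (x : 'rV[T]_n) :
  permv (t * s)%g x = permv s (permv t x).
Proof. by apply/rowP => j; rewrite !mxE invMg permM. Qed.

Lemma permv1 (T : Type) (x : 'rV[T]_n) : permv 1%g x = x.
Proof. by apply/rowP => j; rewrite !mxE invg1 perm1. Qed.

Lemma permvD (T : zmodType) (s : {perm 'I_n}) (x y : 'rV[T]_n) :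
  permv s (x + y) = permv s x + permv s y.
Proof. by apply/rowP => j; rewrite !mxE. Qed.

Lemma permvN (T : zmodType) (s : {perm 'I_n}) (x : 'rV[T]_n) :
  permv s (- x) = - permv s x.
Proof. by apply/rowP => j; rewrite !mxE. Qed.

Lemma permv0 (T : zmodType) (s : {perm 'I_n}) : permv s (0 : 'rV[T]_n) = 0.
Proof. by apply/rowP => j; rewrite !mxE. Qed.

Lemma affperm_mulA : associative affperm_mul.
Proof.
by move=> x y z; congr pair; rewrite /= ?mulgA // permvD permvM addrA.
Qed.

Lemma affperm_mul1x : left_id affperm_one affperm_mul.
Proof.
by case=> l s; rewrite /affperm_mul /= add0r permv1 mulg1.
Qed.

Lemma affperm_mulx1 : right_id affperm_one affperm_mul.
Proof.
by case=> l s; rewrite /affperm_mul /= permv0 addr0 mul1g.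
Qed.

Lemma affperm_mulVx : left_inverse affperm_one affperm_inv affperm_mul.
Proof. by case=> l s; rewrite /affperm_mul /= addNr mulgV. Qed.

Lemma affperm_mulxV : right_inverse affperm_one affperm_inv affperm_mul.
Proof.
case=> l s; rewrite /affperm_mul /= permvN -permvM.
by rewrite mulVg permv1 addrN.
Qed.

HB.instance Definition _ := isGroup.Build affperm
  affperm_mulA affperm_mul1x affperm_mulx1 affperm_mulVx affperm_mulxV.

Definition transl (l : 'rV[int]_n) : affperm := (l, 1%g).

Definition aact (R : pzRingType) (x : affperm) (v : 'rV[R]_n) : 'rV[R]_n :=
  map_mx intr x.1 + permv x.2 v.

Lemma aactM (R : pzRingType) (x y : affperm) (v : 'rV[R]_n) :
  aact (x * y)%g v = aact x (aact y v).
Proof.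
rewrite /aact /= permvD addrA permvM; congr (_ + _).
by apply/rowP => j; rewrite !mxE rmorphD.
Qed.

End AffinePermutations.

Section RootDatum.
Variable m : nat.
Local Notation n := m.*2.+1.

Definition mid : 'I_n := inord m.

Definition Xstar : set 'rV[int]_n :=
  [set x | forall i, x 0 i + x 0 (rev_ord i) = 2 * x 0 mid].

Definition Qvee : set 'rV[int]_n :=
  [set x | [/\ Xstar x, forall i, x 0 i + x 0 (rev_ord i) = 0
             & (2 %| \sum_(i < n | (i < m)%N) x 0 i)%Z]].

Definition Sstar : set {perm 'I_n} :=
  [set s | forall i, s (rev_ord i) = rev_ord (s i)].

Definition Wext : set (affperm n) := [set w | Xstar w.1 /\ Sstar w.2].

Definition Waff : set (affperm n) := [set w | Qvee w.1 /\ Sstar w.2].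

Definition congr_Waff (x y : affperm n) : Prop := Waff (y^-1 * x)%g.

Definition mu (q : nat) : 'rV[int]_n :=
  \row_j (if (j < q)%N then 2 else if (j < n - q)%N then 1 else 0).

(* A_k as a set of indices. *)
Definition Aset (k : nat) (j : 'I_n) : bool := (j < k)%N || (n - k <= j)%N.

End RootDatum.

Section Apartment.
Variables (R : realType) (m : nat).
Local Notation n := m.*2.+1.

(* X_* (x) R, realised inside R^n as the subspace cut out by the equations
   defining X_*. *)
Definition apartment : set 'rV[R]_n :=
  [set x | forall i, x 0 i + x 0 (rev_ord i) = 2 * x 0 (mid m)].

Definition avec (k : nat) : 'rV[R]_n :=
  \row_j (if (j < k)%N then - 2^-1 else if (j < n - k)%N then 0 else 2^-1).

(* The point a_{0'}. *)
Definition avec0' : 'rV[R]_n :=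
  \row_j (if j == ord0 then -1 else if j == ord_max then 1 else 0).

(* Points of the apartment lie in the same facet when they are in the same
   position with respect to every hyperplane x_i - x_j = d. *)
Definition same_facet (x y : 'rV[R]_n) : Prop :=
  forall (i j : 'I_n) (d : int), j != i -> j != rev_ord i ->
    Num.sg (x 0 i - x 0 j - d%:~R) = Num.sg (y 0 i - y 0 j - d%:~R).

Definition facet (F : set 'rV[R]_n) : Prop :=
  exists2 x, apartment x & F = [set y | apartment y /\ same_facet x y].

Definition subfacet (F G : set 'rV[R]_n) : Prop :=
  facet F /\ F `<=` closure G.

Definition minimal_subfacet (F G : set 'rV[R]_n) : Prop :=
  subfacet F G /\ forall F', subfacet F' F -> F' = F.

Definition base_alcove : set 'rV[R]_n :=
  [set x | [/\ apartment x, x 0 ord0 < x 0 (inord 1),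
               x 0 ord_max - 1 < x 0 (inord 1)
             & forall i j : 'I_n, (0 < i)%N -> (i < j)%N -> (j <= m)%N ->
                 x 0 i < x 0 j]].

Definition line (a : 'rV[R]_n) : set 'rV[R]_n :=
  [set a + const_mx c | c in [set: R]].

Variable I : {set 'I_m.+1}.

Definition FI_vertex (a : 'rV[R]_n) : Prop :=
  (exists k : 'I_m.+1, [/\ k \in I, k != 1%N :> nat & a = avec k]) \/
  (inord 1 \in I /\ a = avec0').

Definition is_FI (F : set 'rV[R]_n) : Prop :=
  subfacet F base_alcove /\
  forall L, minimal_subfacet L F <-> exists2 a, FI_vertex a & L = line a.

(* The union of all facets with the property characterising F_I; there is
   exactly one such facet when m >= 1 and I is nonempty. *)
Definition FI : set 'rV[R]_n := \bigcup_(F in is_FI) F.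

Definition WI : set (affperm n) :=
  [set w | Waff w /\ forall k : 'I_m.+1, k \in I -> aact w (avec k) = avec k].

End Apartment.

Section Permissibility.
Variables (R : realType) (m : nat).
Local Notation n := m.*2.+1.

Definition double_coset (J I : {set 'I_m.+1}) (w : set (affperm n)) : Prop :=
  exists2 x, Wext x &
    w = [set (u * x * v)%g | u in @WI R m J & v in @WI R m I].

Definition convex_hull (X : set 'rV[R]_n) : set 'rV[R]_n :=
  smallest (@convex_set R 'rV[R]_n) X.

Definition Conv_orbit (l : 'rV[int]_n) : set 'rV[R]_n :=
  convex_hull [set map_mx intr (permv s l) | s in @Sstar m].

Definition coset_congr (q : nat) (w : set (affperm n)) : Prop :=
  forall x, w x -> congr_Waff x (transl (mu m q)).

Definition mu_permissible (q : nat) (I : {set 'I_m.+1})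
    (w : set (affperm n)) : Prop :=
  coset_congr q w /\
  exists2 x, w x & forall v, FI I v -> Conv_orbit (mu m q) (aact x v - v).

Definition nu (x : affperm n) (k : nat) : 'rV[R]_n :=
  aact x (avec R m k) - avec R m k.

Definition revv (v : 'rV[R]_n) : 'rV[R]_n := \row_j v 0 (rev_ord j).

Definition sp1 (v : 'rV[R]_n) : Prop :=
  v + revv v = const_mx 2 /\ forall j, 0 <= v 0 j <= 2.

Definition sp2 (q : nat) (v : 'rV[R]_n) : Prop :=
  #|[pred j | v 0 j == 2]|%:R
    + 4^-1 * #|[pred j | v 0 j \isn't a Num.int]|%:R <= q%:R :> R.

Definition sp3 (q k : nat) (v : 'rV[R]_n) : Prop :=
  (forall j, v 0 j \is a Num.int) ->
  ~ (exists2 l, Qvee l & v = map_mx intr (mu m q + l)) ->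
  exists2 j, Aset k j & v 0 j = 1.

Definition spin_permissible_at (q : nat) (I : {set 'I_m.+1})
    (x : affperm n) : Prop :=
  (forall k : 'I_m.+1, k \in I -> sp1 (nu x k) /\ sp2 q (nu x k)) /\
  (forall k : 'I_m.+1, k \in I -> (k <= 1)%N -> sp3 q k (nu x k)).

End Permissibility.

(* Main.v *)
Require Import Defs.
From mathcomp Require Import all_boot all_order all_algebra all_fingroup.
From mathcomp Require Import all_classical all_reals all_analysis.
From mathcomp Require Import zify ring lra.

(* The closed base alcove is a simplex times a line whose vertices are the
   points a_k (k <> 1) and a_{0'}, so FI consists of the points whose barycentric
   coordinates are supported exactly on the vertices selected by I.  The
   displacement v |-> wv - v is affine, hence mu-permissibility can be tested at
   these vertices.  There the displacement is half-integral, and a half-integral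
   vector is in the convex hull of the orbit of mu if and only if it satisfies
   v + v^* = 2, 0 <= v <= 2 and sum_j |v(j) - 1| <= 2q, i.e. (sp1) and (sp2).
   The only vertex which is not one of the a_k is a_{0'} = 2 a_1 - a_0; there, the
   bound on the sum at a_1 gives the one at a_{0'} up to an error of 2, which is
   removed by a parity argument using w = t_mu mod Waff, while (sp3) at a_1
   accounts for the bounds 0 <= v <= 2. *)

Set Implicit Arguments.
Unset Strict Implicit.
Unset Printing Implicit Defensive.

Import Order.TTheory GRing.Theory Num.Theory.
Import numFieldNormedType.Exports.

(** * Convexity and segments *)

Section Convexity.
Local Open Scope classical_set_scope.
Local Open Scope ring_scope.
Variables (R : realType) (V : lmodType R).
Implicit Types (A : set V) (x y : V).

(** The facet F_I is relatively open, so in general it misses its own vertices. A condition on F_I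
    therefore reaches them only in the limit, through the closed set [polytope], which contains the
    hull everywhere. On the way back a displacement is a convex combination of displacements at
    vertices, so the inclusion of [polytope] in the hull is wanted only at half-integral points,
    where an explicit descent through convex combinations proves it. The two directions at a_{0'}
    are not symmetric. As a_1 is the midpoint of a_0 and a_{0'}, bounds at a_1 follow by convexity;
    bounds at a_{0'} must be extrapolated. With s the linear part of w and e = s a_{0'} - a_{0'},
    the extrapolation adds e/2 to the displacement at a_1. It can leave the cube only if s exchanges
    the two extreme coordinates, so that e has entries 2 and -2. In that case the displacement at
    a_1 is integral and outside the class of mu, because a_{0'} has an odd sum over its first m
    entries: this is the situation that (sp3) controls. *)

Lemma convex_setE A : @convex_set R V A <->
  forall x y (t : R), 0 <= t <= 1 -> A x -> A y -> A (t *: x + (1 - t) *: y).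
Proof.
split=> [cA x y t t01 Ax Ay|cA x y t].
  have t01' : Itv.spec (@Itv.num_sem R) (Itv.Real `[0%Z, 1%Z]) t.
    rewrite /= /Itv.num_sem /= num_real /= in_itv /=.
    by case/andP: t01 => -> ->.
  have := cA x y (Itv.mk t01'); rewrite !inE; exact.
rewrite !inE; apply: cA; exact/andP.
Qed.

(** Points of weight zero are left unconstrained: displacements will be controlled only at the
    vertices that carry positive weight. *)
Lemma convex_sum (I : finType) A (c : I -> R) (w : I -> V) :
  @convex_set R V A -> (forall i, 0 <= c i) -> \sum_i c i = 1 ->
  (forall i, 0 < c i -> A (w i)) -> A (\sum_i c i *: w i).
Proof.
move=> /convex_setE cA c0 c1 Aw.
have key (r : seq I) : 0 < \sum_(i <- r) c i ->
    A ((\sum_(i <- r) c i)^-1 *: \sum_(i <- r) c i *: w i).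
  elim: r => [|i r IHr]; first by rewrite big_nil ltxx.
  rewrite !big_cons; set S := \sum_(j <- r) c j.
  have S0 : 0 <= S by apply: sumr_ge0.
  move: (c0 i); rewrite le0r => /predU1P[ci0|ci_gt0].
    by rewrite ci0 scale0r !add0r; exact: IHr.
  move=> cS; move: S0; rewrite le0r => /predU1P[S0|S_gt0].
    rewrite S0 addr0.
    have -> : \sum_(j <- r) c j *: w j = 0.
      rewrite big_seq big1 // => j jr; have /eqP := S0.
      rewrite /S psumr_eq0 // => /allP /(_ j jr) /eqP ->.
      by rewrite scale0r.
    by rewrite addr0 scalerA mulVf ?gt_eqF // scale1r; exact: Aw.
  have -> : (c i + S)^-1 *: (c i *: w i + \sum_(j <- r) c j *: w j) =
     (c i / (c i + S)) *: w i + (1 - c i / (c i + S)) *: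
       (S^-1 *: \sum_(j <- r) c j *: w j).
    rewrite scalerDr !scalerA mulrC; congr (_ + _ *: _).
    have cS0 : c i + S != 0 by rewrite gt_eqF.
    rewrite -[1](divff cS0) -mulrBl [c i + S - _]addrC addKr.
    by rewrite mulrAC divff ?mul1r // gt_eqF.
  apply: cA; [|exact: Aw|exact: IHr].
  by rewrite divr_ge0 ?(ltW cS) ?c0 // ler_pdivrMr // mul1r lerDl ltW.
by have := key (index_enum I); rewrite c1 invr1 scale1r; apply.
Qed.

End Convexity.

Section Segments.
Local Open Scope classical_set_scope.
Local Open Scope ring_scope.
Variables (R : realType) (n : nat).
Implicit Types (S : set 'rV[R]_n) (x y : 'rV[R]_n).

Lemma closure_segment S x y :
  (forall t : R, 0 < t <= 1 -> S ((1 - t) *: x + t *: y)) -> closure S x.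
Proof.
move=> seg B Bx.
have cvg : (fun t : R => (1 - t) *: x + t *: y) @ 0 --> x.
  have -> : (fun t : R => (1 - t) *: x + t *: y) = (fun t => x + t *: (y - x)).
    by apply/funext => t; rewrite scalerBl scale1r scalerBr addrA addrAC.
  rewrite -[X in _ --> X](addr0 x); apply: cvgD; first exact: cvg_cst.
  rewrite -[X in _ --> X](scale0r (y - x)).
  by apply: cvgZr_tmp; exact: cvg_id.
have /nbhs_ballP[e /= e0 eB] := cvg _ Bx.
have [t t0 /andP[te t1]] : exists2 t : R, 0 < t & (t < e) && (t <= 1).
  exists (Num.min (e / 2) 1); first by rewrite lt_min ltr01 andbT divr_gt0.
  by rewrite ge_min lexx orbT andbT gt_min ltr_pdivrMr // ltr_pMr // ltr1n.
exists ((1 - t) *: x + t *: y); split; first by apply: seg; rewrite t0.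
by apply: eB; rewrite -ball_normE /= sub0r normrN gtr0_norm.
Qed.

Lemma closure_ge0 S (f : 'rV[R]_n -> R) x :
  continuous f -> (forall y, S y -> 0 <= f y) -> closure S x -> 0 <= f x.
Proof.
move=> fc fS Sx.
have clF : closed [set y | 0 <= f y].
  by apply: (@closed_comp _ _ f [set z | 0 <= z]) => [? _|]; [exact: fc|exact: closed_ge].
have /closure_id E := clF.
suff : closure [set y | 0 <= f y] x by rewrite -E.
exact: (closure_subset fS).
Qed.

End Segments.

(** * Row vectors and the involution *)

Section Folding.
Local Open Scope ring_scope.
Variable m : nat.
Local Notation n := m.*2.+1.

Lemma val_mid : mid m = m :> nat.
Proof. by rewrite /mid inordK //; lia. Qed.

Lemma val_rev_ord (i : 'I_n) : rev_ord i = (m.*2 - i)%N :> nat.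
Proof. by rewrite /= subSS. Qed.

Lemma rev_mid : rev_ord (mid m) = mid m.
Proof. by apply: ord_inj; rewrite val_rev_ord val_mid; lia. Qed.

Lemma sum_fold (V : nmodType) (F : 'I_n -> V) :
  \sum_j F j = \sum_(j : 'I_n | (j < m)%N) (F j + F (rev_ord j)) + F (mid m).
Proof.
rewrite (bigID (fun j : 'I_n => (j < m)%N)) /= big_split /= -addrA; congr (_ + _).
rewrite (bigD1 (mid m)) /=; last by rewrite val_mid ltnn.
rewrite addrC; congr (_ + _).
rewrite (reindex_inj rev_ord_inj) /=; apply: eq_bigl => j.
rewrite -(inj_eq (@ord_inj _)) val_mid val_rev_ord.
by have := ltn_ord j; lia.
Qed.

Lemma sum_fold_sym (V : nmodType) (F : 'I_n -> V) :
  (forall j, F (rev_ord j) = F j) ->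
  \sum_j F j = (\sum_(j : 'I_n | (j < m)%N) F j) *+ 2 + F (mid m).
Proof.
move=> Fs; rewrite sum_fold -sumrMnl; congr (_ + _).
by apply: eq_bigr => j _; rewrite Fs mulr2n.
Qed.

End Folding.

(** * Sorting by permutations that commute with the involution *)

Section Rank.
Local Open Scope ring_scope.
Variables (m : nat) (z : 'I_m.*2.+1 -> int).
Local Notation n := m.*2.+1.

(* The stable rank for the decreasing order on the values of z; when z is
   antisymmetric it commutes with [rev_ord]. *)
Definition before (i j : 'I_n) := (z j < z i) || (z i == z j) && (i < j)%N.

Definition rank_nat (j : 'I_n) : nat := #|[set i | before i j]|.

Lemma rank_nat_lt j : (rank_nat j < n)%N.
Proof.
rewrite -[X in (_ < X)%N]card_ord -cardsT; apply: proper_card.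
rewrite finset.properEneq finset.subsetT andbT; apply/eqP => /finset.setP /(_ j).
by rewrite !inE /before ltxx ltnn andbF.
Qed.

Definition rank_ord j : 'I_n := Ordinal (rank_nat_lt j).

Lemma rank_ord_inj : injective rank_ord.
Proof.
suff lt_rank i j : before i j -> (rank_nat i < rank_nat j)%N.
  move=> i j /(congr1 val) /= eq_ij; apply/val_inj/eqP.
  case: (boolP (before i j)) => [/lt_rank|]; first by rewrite eq_ij ltnn.
  case: (boolP (before j i)) => [/lt_rank|]; first by rewrite eq_ij ltnn.
  rewrite /before !negb_or !negb_and -!leNgt -!leqNgt => /andP[zij c1] /andP[zji c2].
  have zE : z i == z j by rewrite eq_le zij zji.
  move: c1 c2; rewrite zE eq_sym zE /= => c1 c2.
  by apply/eqP; lia.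
move=> bij; apply: proper_card; apply/properP; split.
  apply/fintype.subsetP => k; rewrite !inE.
  by move: bij; rewrite /before; lia.
exists i; rewrite !inE //.
by rewrite /before ltxx ltnn andbF.
Qed.

Definition rank_perm : {perm 'I_n} := perm rank_ord_inj.

(** Negating values and reversing indices turns the order [before] around, ties included. Hence the
    predecessors of [rev_ord j] correspond to the successors of [j], and predecessors and successors
    of [j] together number 2m. *)
Lemma rank_perm_Sstar :
  (forall j, z (rev_ord j) = - z j) -> Sstar rank_perm.
Proof.
move=> zN j; apply: ord_inj; rewrite val_rev_ord !permE /= /rank_nat.
have -> : #|[set i | before i (rev_ord j)]| = #|[set i | before j i]|.
  rewrite -(card_imset _ (@rev_ord_inj n)); apply: eq_card => i.
  rewrite inE; apply/imsetP/idP => [[k]|bji].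
    rewrite inE => bk ->; move: bk; rewrite /before !zN /= => bk.
    by have := ltn_ord k; have := ltn_ord j; lia.
  exists (rev_ord i); rewrite ?rev_ordK // inE; move: bji.
  rewrite /before !zN /=.
  by have := ltn_ord i; have := ltn_ord j; lia.
have : (#|[set i | before j i]| + #|[set i | before i j]| = m.*2)%N.
  have -> : [set i | before i j] = (finset.setC [set i | before j i]) :\ j.
    apply/finset.setP => i; rewrite !inE /before.
    have [->|] := eqVneq i j; first by rewrite ltxx ltnn andbF.
    by rewrite -(inj_eq (@ord_inj _)) /=; lia.
  have := cardsC [set i | before j i]; rewrite card_ord.
  rewrite (cardsD1 j (finset.setC _)) !inE {2}/before ltxx ltnn andbF /=.
  by lia.
by lia.
Qed.

End Rank.

(** * The polytope spanned by the orbit of mu *)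

Section Orbit.
Local Open Scope ring_scope.
Variables (m q : nat) (z : 'rV[int]_m.*2.+1).
Local Notation n := m.*2.+1.
Hypotheses (zN : forall j, z 0 (rev_ord j) = - z 0 j)
  (z3 : forall j, [|| z 0 j == 0, z 0 j == 2 | z 0 j == -2])
  (zq : (\sum_(j : 'I_n | (j < m)%N) absz (z 0%R j))%N = q.*2).

Lemma card_eq2 : #|[set j | z 0 j == 2]| = q.
Proof.
rewrite -sum1dep_card big_mkcond /= (@sum_fold m nat).
rewrite (_ : z 0 (mid m) == 2 = false); last by have := zN (mid m); rewrite rev_mid; lia.
rewrite addr0; apply: double_inj; rewrite -zq -mul2n -[LHS]/(2 * _)%N big_distrr /=.
apply: eq_bigr => j _; rewrite zN; have := z3 j.
by case/or3P => /eqP ->.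
Qed.

Lemma card_eqN2 : #|[set j | z 0 j == -2]| = q.
Proof.
rewrite -[RHS]card_eq2 -(card_imset _ (@rev_ord_inj n)); apply: eq_card => i.
rewrite [RHS]inE; apply/imsetP/idP => [[k]|zi].
  by rewrite inE => /eqP zk ->; rewrite zN zk.
by exists (rev_ord i); rewrite ?rev_ordK // inE zN (eqP zi).
Qed.

(** Sorting moves the q entries 2 of [z] to the front and the q entries -2 to the end, exactly where
    [mu] has its entries 2 and 0. *)
Lemma mu_rank j : mu m q 0 (rank_ord (z 0) j) = 1 + (z 0 j == 2)%:Z - (z 0 j == -2)%:Z.
Proof.
rewrite mxE /= /rank_nat.
have cN2 := cardsC [set i | z 0 i == -2].
rewrite card_eqN2 card_ord in cN2.
have nq := etrans (esym (addKn q _)) (congr1 (subn^~ q) cN2).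
have [zj|[zj|zj]] : z 0 j = 0 \/ z 0 j = 2 \/ z 0 j = -2.
- by have := z3 j; case/or3P => /eqP; auto.
- rewrite zj /= addr0 ltnNge -{1}card_eq2 subset_leq_card /=; last first.
    by apply/fintype.subsetP => i; rewrite !inE /before zj => /eqP ->.
  rewrite ifT //.
  have : (#|[set i | before (z 0%R) i j]| < #|finset.setC [set i | z 0%R i == (-2)%R]|)%N.
    apply: proper_card; apply/properP; split.
      by apply/fintype.subsetP => i; rewrite !inE /before zj; have := z3 i; lia.
    by exists j; rewrite !inE ?zj // /before ltxx ltnn andbF.
  by rewrite nq.
- rewrite zj /= ifT // -{1}card_eq2; apply: proper_card; apply/properP; split.
    by apply/fintype.subsetP => i; rewrite !inE /before zj; have := z3 i; lia.
  by exists j; rewrite !inE ?zj // /before ltxx ltnn andbF.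
- have le1 : (n - q <= #|[set i | before (z 0%R) i j]|)%N.
    rewrite -nq subset_leq_card //.
    by apply/fintype.subsetP => i; rewrite !inE /before zj; have := z3 i; lia.
  have le2 : (q <= n - q)%N.
    rewrite -nq -{1}card_eq2 subset_leq_card //.
    by apply/fintype.subsetP => i; rewrite !inE => /eqP ->.
  by rewrite zj ltnNge (leq_trans le2 le1) ltnNge le1.
Qed.

End Orbit.

Section Polytope.
Local Open Scope classical_set_scope.
Local Open Scope ring_scope.
Variables (R : realType) (m : nat).
Local Notation n := m.*2.+1.
Implicit Types (v : 'rV[R]_n) (z : 'rV[int]_n).

(** Around the centre (1,...,1) this is a cube cut by an l1-ball, within the skew vectors. The sum
    runs over both members of each opposite pair, hence the bound 2q rather than q. *)
Definition polytope (q : nat) : set 'rV[R]_n :=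
  [set v | [/\ v + revv v = const_mx 2, forall j, 0 <= v 0 j <= 2
     & \sum_j `|v 0 j - 1| <= (q.*2)%:R]].

Lemma Sstar_inv s : Sstar (m := m) s -> Sstar s^-1%g.
Proof. by move=> Ss j; apply: (@perm_inj _ s); rewrite Ss !permKV. Qed.

Lemma sum_const2P v : v + revv v = const_mx 2 <->
  forall j, v 0 j + v 0 (rev_ord j) = 2.
Proof.
split=> [/rowP vE j|vE]; first by have := vE j; rewrite !mxE.
by apply/rowP => j; rewrite !mxE.
Qed.

Lemma polytope_convex q : @convex_set R 'rV[R]_n (polytope q).
Proof.
apply/convex_setE => x y t t01 [/sum_const2P xs x02 xq] [/sum_const2P ys y02 yq].
split.
- apply/sum_const2P => j; rewrite !mxE; move: (xs j) (ys j) => e1 e2.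
  have -> : x 0 (rev_ord j) = 2 - x 0 j by lra.
  have -> : y 0 (rev_ord j) = 2 - y 0 j by lra.
  by ring.
- by move=> j; rewrite !mxE; move: (x02 j) (y02 j) t01; nra.
- have le1 : \sum_j `|(t *: x + (1 - t) *: y) 0 j - 1| <=
     t * \sum_j `|x 0 j - 1| + (1 - t) * \sum_j `|y 0 j - 1|.
    rewrite !mulr_sumr -big_split /=; apply: ler_sum => j _.
    have t0 : 0 <= t by lra.
    have t1 : 0 <= 1 - t by lra.
    have -> : (t *: x + (1 - t) *: y) 0 j - 1 =
      t * (x 0 j - 1) + (1 - t) * (y 0 j - 1) by rewrite !mxE; ring.
    by apply: le_trans (ler_normD _ _) _; rewrite !normrM (ger0_norm t0) (ger0_norm t1).
  by apply: le_trans le1 _; nra.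
Qed.

Lemma polytope_permv q s v : Sstar s -> polytope q v -> polytope q (permv s v).
Proof.
move=> Ss [/sum_const2P vs v02 vq].
split=> [|j|]; first by apply/sum_const2P => j; rewrite !mxE (Sstar_inv Ss).
  by rewrite mxE.
rewrite (reindex_inj (@perm_inj _ s)) /=.
by under eq_bigr do rewrite mxE permK.
Qed.

Lemma mu_polytope q : (q <= m)%N -> polytope q (map_mx intr (mu m q)).
Proof.
move=> qm; split.
- apply/sum_const2P => j; rewrite !mxE -intrD val_rev_ord.
  apply: (congr1 (intr : int -> R) (_ : _ = 2)).
  have := ltn_ord j; repeat (case: ltnP => ?); lia.
- move=> j; rewrite !mxE; case: ifP => _; first by rewrite lexx ler0n.
  by case: ifP => _ //; rewrite ?ler01 ?ler1n ?lexx ?ler0n.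
- rewrite (eq_bigr (fun j : 'I_n => (((j < q) || (n - q <= j))%N : nat)%:R)).
    rewrite -natr_sum ler_nat.
    rewrite (@sum_fold m nat) val_mid.
    rewrite (eq_bigr (fun j : 'I_n => if (j < q)%N then 2 else 0)%N); last first.
      by move=> j; rewrite val_rev_ord; have := ltn_ord j; case: ifP; lia.
    have -> : ((m < q) || (m.*2.+1 - q <= m))%N = false by lia.
    rewrite addr0 -big_mkcondr /=.
    rewrite (eq_bigl (fun j : 'I_n => (j < q)%N)); last by move=> j; lia.
    have qn : (q <= n)%N by lia.
    rewrite (big_ord_narrow qn) (@big_const_ord nat).
    rewrite (_ : iter q _ _ = q.*2) //.
  move=> j _; rewrite !mxE; case: ltnP => /= jq.
    by rewrite -[1 in LHS]/(1%:~R) -intrB normr1.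
  case: ltnP => _ /=; first by rewrite subrr normr0.
  by rewrite mulr0z sub0r normrN normr1.
Qed.

Lemma Conv_orbit_convex l : @convex_set R 'rV[R]_n (@Conv_orbit R m l).
Proof.
apply/convex_setE => x y t t01 Cx Cy A AP.
by case: (AP) => /= /convex_setE cA _; apply: cA; [|exact: Cx|exact: Cy].
Qed.

Lemma Conv_sub_polytope q : (q <= m)%N -> @Conv_orbit R m (mu m q) `<=` polytope q.
Proof.
move=> qm; apply: smallest_sub; first exact: polytope_convex.
move=> _ [s Ss <-].
have -> : map_mx intr (permv s (mu m q)) = permv s (map_mx intr (mu m q)) :> 'rV[R]_n.
  by apply/rowP => j; rewrite !mxE.
by apply: polytope_permv => //; exact: mu_polytope.
Qed.

End Polytope.

(** * Half-integral points of the polytope *)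

Section HalfIntegral.
Local Open Scope classical_set_scope.
Local Open Scope ring_scope.
Variables (R : realType) (m : nat).
Local Notation n := m.*2.+1.
Implicit Types (v : 'rV[R]_n) (z : 'rV[int]_n) (i j : 'I_n) (c : int).

(* 1 + z/2: half-integral vectors are encoded by antisymmetric integral ones. *)
Definition half_row z : 'rV[R]_n := \row_j (1 + (z 0 j)%:~R / 2).

Definition set_pair z (i : 'I_n) (c : int) : 'rV[int]_n :=
  \row_j (if j == i then c else if j == rev_ord i then - c else z 0 j).

Definition skew_row z := forall j, z 0 (rev_ord j) = - z 0 j.

Definition half_sum (F : nat -> nat) z : nat :=
  (\sum_(j : 'I_n | (j < m)%N) F (absz (z ord0 j)))%N.

(** The descent measure must be strictly concave: trading two entries of absolute value 1 for 0 and
    2 keeps the l1-norm, but lowers the sum of gaps from 6 to 4. *)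
Definition gap (a : nat) : nat := (4 - a ^ 2)%N.

Lemma rev_neq (i : 'I_n) : (i < m)%N -> (rev_ord i == i) = false.
Proof. by move=> im; apply/eqP => /(congr1 val) /= ; rewrite subSS; lia. Qed.

Lemma set_pair_skew z i c : (i < m)%N -> skew_row z -> skew_row (set_pair z i c).
Proof.
move=> im zN j; rewrite !mxE (inj_eq rev_ord_inj).
rewrite -{1}[i]rev_ordK (inj_eq rev_ord_inj) zN.
have [->|_] := eqVneq j i; first by rewrite eq_sym rev_neq.
by case: ifP; rewrite ?opprK.
Qed.

Lemma half_sum_set_pair F z i c : (i < m)%N ->
  (half_sum F (set_pair z i c) + F (absz (z ord0 i)) = half_sum F z + F (absz c))%N.
Proof.
move=> im; rewrite /half_sum (bigD1 i) //= [in RHS](bigD1 i) //= mxE eqxx.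
rewrite (eq_bigr (fun j => F (absz (z ord0 j)))); first by lia.
move=> j /andP[jm ji]; rewrite mxE (negPf ji) ifF //.
by apply/eqP => /(congr1 val) /=; rewrite subSS; lia.
Qed.

Lemma half_sum_set_pair2 F z i j a b : (i < m)%N -> (j < m)%N -> i != j ->
  (half_sum F (set_pair (set_pair z i a) j b) + F (absz (z ord0 i)) + F (absz (z ord0 j))
   = half_sum F z + F (absz a) + F (absz b))%N.
Proof.
move=> im jm ij; have := half_sum_set_pair F (set_pair z i a) b jm.
have -> : set_pair z i a ord0 j = z ord0 j.
  rewrite mxE eq_sym (negPf ij) ifF //.
  by apply/eqP => /(congr1 val) /=; rewrite subSS; lia.
by have := half_sum_set_pair F z a im; rewrite addnAC => <- ->; rewrite addnAC.
Qed.

Lemma half_set_pair z i (a b : int) (t : R) : skew_row z ->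
  (z 0 i)%:~R = t * a%:~R + (1 - t) * b%:~R :> R ->
  half_row z = t *: half_row (set_pair z i a) + (1 - t) *: half_row (set_pair z i b).
Proof.
move=> zN zi; apply/rowP => j; rewrite !mxE.
have [->|_] := eqVneq j i; first by rewrite zi; ring.
have [->|_] := eqVneq j (rev_ord i); last by ring.
by rewrite zN !rmorphN /= zi; ring.
Qed.

Lemma half_set_pair2 z i j (a b : int) : skew_row z -> i != j -> i != rev_ord j ->
  half_row z = (1 / 2) *: half_row (set_pair (set_pair z i (z 0 i + a)) j (z 0 j + b))
    + (1 - 1 / 2) *: half_row (set_pair (set_pair z i (z 0 i - a)) j (z 0 j - b)).
Proof.
move=> zN ij ij'; apply/rowP => k; rewrite !mxE.
have [->|_] := eqVneq k j; first by rewrite rmorphB rmorphD /=; field.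
have [->|_] := eqVneq k (rev_ord j); first by rewrite zN !rmorphN rmorphB rmorphD /=; field.
have [->|_] := eqVneq k i; first by rewrite rmorphB rmorphD /=; field.
have [->|_] := eqVneq k (rev_ord i); first by rewrite zN !rmorphN rmorphB rmorphD /=; field.
by field.
Qed.

Variable q : nat.

Lemma half_orbit z : skew_row z ->
  (forall j, [|| z 0 j == 0, z 0 j == 2 | z 0 j == -2]) ->
  half_sum id z = q.*2 -> Conv_orbit (mu m q) (half_row z).
Proof.
move=> zN z3 zq; apply: sub_gen_smallest.
(* [permv s] reads its argument at [s^-1 j], whereas [mu] has to be read at the rank of [j]; hence
   the inverse. *)
exists (rank_perm (z 0))^-1%g; first exact/Sstar_inv/rank_perm_Sstar.
apply/rowP => j; rewrite !mxE invgK permE.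
have := mu_rank zN z3 zq j; rewrite mxE => ->.
by have /or3P[] := z3 j => /eqP -> /=; rewrite ?rmorphD ?rmorphN /=; field.
Qed.

Hypothesis qm : (q <= m)%N.

Lemma half_Conv z : skew_row z -> (forall j, (absz (z ord0 j) <= 2)%N) ->
  (half_sum id z <= q.*2)%N -> Conv_orbit (mu m q) (half_row z).
Proof.
have cC : forall x y (t : R), 0 <= t <= 1 -> Conv_orbit (mu m q) x ->
    Conv_orbit (mu m q) y -> Conv_orbit (mu m q) (t *: x + (1 - t) *: y).
  by apply/convex_setE; exact: Conv_orbit_convex.
have [g0 g1 g2] : [/\ gap 0 = 4, gap 1 = 3 & gap 2 = 0]%N by [].
have [N] := ubnP (half_sum gap z).
elim: N z => // N IHN z zN' zN z2 zq.
have set_pair_le2 i c : (absz c <= 2)%N -> forall j, (absz (set_pair z i c ord0 j) <= 2)%N.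
  by move=> c2 j; rewrite mxE; case: ifP => // _; case: ifP => // _; rewrite abszN.
(* While possible, a pair of opposite entries is pushed to +-2 in both ways; then
   two entries +-1 are traded for 0 and +-2.  Both steps decrease the sum of the
   gaps, and what remains is in the orbit by parity. *)
case: (pselect (exists2 i : 'I_n, (i < m)%N & (absz (z ord0 i) < 2)%N &&
   (half_sum id z + 2 <= q.*2 + absz (z ord0 i))%N)) => [[i im /andP[zi2 zi]]|no1].
  have E c := half_sum_set_pair id z c im.
  have E2 c := half_sum_set_pair gap z c im.
  have d : (0 < gap (absz (z ord0 i)))%N by move: zi2; case: absz => [|[]].
  (* The weight t solves z_i = 2t - 2(1 - t). *)
  rewrite (@half_set_pair z i 2 (-2) (((z 0 i)%:~R + 2) / 4)) //; last first.
    by rewrite rmorphN /=; field.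
  apply: cC.
  - have : -2 <= z 0 i <= 2 by move: zi2; rewrite (_ : ord0 = 0) //; lia.
    by rewrite -2!(ler_int R) rmorphN /= => /andP[]; lra.
  - apply: IHN => //; [|exact: set_pair_skew|exact: set_pair_le2|].
      by have := E2 2; rewrite (_ : absz 2 = 2%N) // g2; lia.
    by have := E 2; rewrite /=; lia.
  - apply: IHN => //; [|exact: set_pair_skew|exact: set_pair_le2|].
      by have := E2 (-2); rewrite (_ : absz (-2) = 2%N) // g2; lia.
    by have := E (-2); rewrite /=; lia.
case: (pselect (exists i j : 'I_n, [/\ (i < m)%N, (j < m)%N, i != j,
    absz (z ord0 i) = 1%N & absz (z ord0 j) = 1%N])).
  move=> [i [j [im jm ij zi zj]]].
  (* Adding and subtracting (z_i, -z_j) turns (z_i, z_j) into (2 z_i, 0) and (0, 2 z_j). *)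
  rewrite (@half_set_pair2 z i j (z 0 i) (- z 0 j)) //; last first.
    by apply/eqP => /(congr1 val) /=; rewrite subSS; lia.
  have a2 k : absz (z ord0 k) = 1%N -> absz (z 0 k + z 0 k) = 2%N.
    by rewrite (_ : ord0 = 0) //; lia.
  have step a b : (absz a <= 2)%N -> (absz b <= 2)%N ->
      (gap (absz a) + gap (absz b) < 6)%N -> (absz a + absz b <= 2)%N ->
      Conv_orbit (mu m q) (half_row (set_pair (set_pair z i a) j b)).
    move=> a_le2 b_le2 gab ab.
    have E1 := half_sum_set_pair2 gap z a b im jm ij.
    have E2 := half_sum_set_pair2 id z a b im jm ij.
    rewrite zi zj g1 in E1; rewrite zi zj in E2.
    apply: IHN.
    - move: E1 zN' gab; move: (half_sum _ _) (half_sum _ _) => A B; lia.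
    - by apply: set_pair_skew => //; exact: set_pair_skew.
    - move=> k; rewrite mxE; case: ifP => // _; case: ifP => [_|_]; last exact: set_pair_le2.
      by rewrite abszN.
    - move: E2 zq ab; move: (half_sum _ _) (half_sum _ _) => A B; lia.
  rewrite !addrN opprK.
  by apply: cC; [lra|apply: step|apply: step]; rewrite ?a2.
move=> no2.
(* A single entry of absolute value 1 makes the half sum odd, hence at most 2q - 1; this leaves room
   to push that entry to 2, contrary to [no1]. *)
have no_half i : (i < m)%N -> absz (z ord0 i) != 1%N.
  move=> im; apply/eqP => zi; apply: no1; exists i => //.
  have Sodd : half_sum id z =
      (1 + 2 * \sum_(j : 'I_n | (j < m) && (j != i)) (absz (z ord0 j))./2)%N.
    rewrite /half_sum (bigD1 i) //= zi big_distrr /=; congr addn.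
    apply: eq_bigr => j /andP[jm ji].
    have : absz (z ord0 j) <> 1%N.
      by move=> zj; apply: no2; exists i, j; rewrite eq_sym.
    by move: (z2 j); case: absz => [|[|[|]]].
  by rewrite zi; move: zq; rewrite Sodd; lia.
have Seven : half_sum id z = (2 * \sum_(j : 'I_n | (j < m)%N) (absz (z ord0 j))./2)%N.
  rewrite /half_sum big_distrr /=; apply: eq_bigr => j jm.
  by move: (z2 j) (no_half j jm); case: absz => [|[|[|]]].
have z3 i : (i < m)%N -> absz (z ord0 i) = 0%N \/ absz (z ord0 i) = 2%N.
  by move=> im; move: (z2 i) (no_half i im); case: absz => [|[|[|]]]; auto.
apply: half_orbit => //.
  have z3' j : (j < m)%N -> [|| z 0 j == 0, z 0 j == 2 | z 0 j == -2].
    by move=> jm; have := z3 j jm; rewrite (_ : ord0 = 0) //; lia.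
  move=> j; have [/z3' //|jm] := ltnP j m.
  have [jm'|jm'] := eqVneq (j : nat) m.
    have := zN j; rewrite (_ : rev_ord j = j); first by lia.
    by apply: ord_inj; rewrite val_rev_ord; lia.
  have := z3' (rev_ord j); rewrite zN val_rev_ord.
  by move=> /(_ ltac:(have := ltn_ord j; lia)); lia.
(* The half sum is even. If it were less than 2q, a zero entry could still be pushed to 2 within the
   bound; so all entries would be 2 or -2, and the half sum would be 2m, which is at least 2q. *)
apply/eqP; rewrite eqn_leq zq leqNgt; apply/negP => Sq.
suff : half_sum id z = m.*2 by lia.
rewrite /half_sum (eq_bigr (fun=> 2%N)) => [|i im].
  have mn : (m <= n)%N by lia.
  by rewrite (big_ord_narrow mn) (@big_const_ord nat) iter_addn_0 mul2n.
case: (z3 i im) => // zi; case: no1; exists i => //.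
by rewrite zi; move: Sq; rewrite Seven; lia.
Qed.

End HalfIntegral.

(** * Barycentric coordinates on the base alcove *)

Section Barycentric.
Local Open Scope classical_set_scope.
Local Open Scope ring_scope.
Variables (R : realType) (m : nat).
Local Notation n := m.*2.+1.
Implicit Types (x y : 'rV[R]_n) (i j : 'I_n).
Hypothesis m_gt0 : (0 < m)%N.

(* The index 1, which is not the index of a vertex, is used for a_{0'}. *)
Definition vtx (k : nat) : 'rV[R]_n :=
  if k == 1%N then avec0' R m else avec R m k.

(* The k-th barycentric coordinate is a multiple of the affine root vanishing on
   the wall opposite to [vtx k]. *)
Definition wall_fst (k : nat) : 'I_n := inord (maxn k 1).
Definition wall_snd (k : nat) : 'I_n := if k == 0%N then ord_max else inord k.-1.

Definition bary x (k : nat) : R :=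
  (if (k < 2)%N then 1 else 2) *
  (x 0 (wall_fst k) - x 0 (wall_snd k) + (k == 0%N)%:R).

Lemma val_wall_fst k : (k <= m)%N -> wall_fst k = maxn k 1 :> nat.
Proof. by move=> km; rewrite inordK //; lia. Qed.

Lemma val_wall_snd k : (k <= m)%N ->
  wall_snd k = (if k == 0%N then m.*2 else k.-1) :> nat.
Proof. by move=> km; rewrite /wall_snd; case: eqP => // _; rewrite inordK //; lia. Qed.

(** [same_facet] sees only hyperplanes x_i - x_j = d with j distinct from i and from its opposite;
    this lemma and the next place the walls among them. *)
Lemma wall_neq k : (k <= m)%N -> wall_snd k != wall_fst k.
Proof.
move=> km; rewrite -(inj_eq (@ord_inj _)) val_wall_fst // val_wall_snd //.
by case: (k =P 0%N); lia.
Qed.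

Lemma wall_neq_rev k : (k <= m)%N -> wall_snd k != rev_ord (wall_fst k).
Proof.
move=> km; rewrite -(inj_eq (@ord_inj _)) val_rev_ord val_wall_fst // val_wall_snd //.
by case: (k =P 0%N); lia.
Qed.

Lemma vtxE k j : (k <= m)%N -> vtx k 0 j =
  if k == 1%N then (if j == 0%N :> nat then -1 else if j == m.*2 :> nat then 1 else 0)
  else (if (j < k)%N then - 2^-1 else if (j < n - k)%N then 0 else 2^-1).
Proof. by move=> km; rewrite /vtx; case: (k == 1%N); rewrite !mxE. Qed.

Lemma vtx_rev k j : (k <= m)%N -> vtx k 0 (rev_ord j) = - vtx k 0 j.
Proof.
move=> km; rewrite !vtxE // val_rev_ord; have jn := ltn_ord j.
case: eqP => _.
  case: (j =P 0%N :> nat) => [->|j0].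
    by rewrite subn0 eqxx ifF ?opprK //; lia.
  case: (j =P m.*2 :> nat) => [->|j2]; first by rewrite subnn eqxx.
  by rewrite !ifF ?oppr0 //; lia.
case: (ltnP j k) => jk; first by rewrite !ifF ?opprK //; lia.
by case: (ltnP j (n - k)) => jnk; [rewrite ifF ?ifT ?oppr0 //; lia | rewrite ifT //; lia].
Qed.

Lemma vtx_mid k : (k <= m)%N -> vtx k 0 (mid m) = 0.
Proof.
move=> km; have := vtx_rev (mid m) km; rewrite rev_mid; lra.
Qed.

Lemma apartment_skew x : (forall j, x 0 (rev_ord j) = - x 0 j) -> apartment x.
Proof.
move=> xN i; rewrite xN.
by have := xN (mid m); rewrite rev_mid => ?; lra.
Qed.

Lemma vtx_apartment k : (k <= m)%N -> apartment (vtx k).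
Proof. by move=> km; apply: apartment_skew => j; exact: vtx_rev. Qed.

(** Opposite indices have to be excluded: the extreme entries of a_{0'} differ by 2. *)
Lemma vtx_bound k i j : (k <= m)%N -> (i < j)%N -> j != rev_ord i ->
  -1 <= vtx k 0 i - vtx k 0 j <= 0.
Proof.
move=> km ij; rewrite -(inj_eq (@ord_inj _)) val_rev_ord !vtxE // => jri.
have := ltn_ord j => jn; have [k1|k1] := eqVneq k 1%N.
  case: (i =P 0%N :> nat) => i0; case: (j =P m.*2 :> nat) => j2; try lia.
  - by rewrite ifF; [lra|lia].
  - by rewrite ifF; [rewrite ifF; [lra|lia]|lia].
  - by rewrite ifF; [rewrite ifF; [lra|lia]|lia].
by case: (ltnP i k) => ?; case: (ltnP j k) => ?; case: (ltnP i (n - k)) => ?;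
  case: (ltnP j (n - k)) => ?; try lia; lra.
Qed.

Lemma bary_vtx (i k : nat) : (i <= m)%N -> (k <= m)%N -> bary (vtx i) k = (i == k)%:R.
Proof.
move=> im km; rewrite /bary !vtxE // val_wall_fst // val_wall_snd //.
have [k0|k0] := eqVneq k 0%N.
  rewrite k0 max0n; have [->|i1] := eqVneq i 1%N.
    by rewrite /=; repeat (case: ifP => ?); try lia; lra.
  have [->|i0] := eqVneq i 0%N.
    by rewrite /=; repeat (case: ifP => ?); try lia; lra.
  by rewrite /=; repeat (case: ifP => ?); try lia; lra.
have -> : maxn k 1 = k by lia.
have [k1|k1] := eqVneq k 1%N.
  rewrite k1; have [i1|i1] := eqVneq i 1%N.
    by rewrite ?i1 /=; repeat (case: ifP => ?); try lia; lra.
  by rewrite /=; repeat (case: ifP => ?); try lia; lra.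
have [i1|i1] := eqVneq i 1%N.
  rewrite ?i1 (_ : (1 == k)%N = false); last by lia.
  by rewrite /=; repeat (case: ifP => ?); try lia; lra.
have [ik|ik] := eqVneq i k.
  rewrite ?ik; by rewrite /=; repeat (case: ifP => ?); try lia; lra.
by rewrite /=; repeat (case: ifP => ?); try lia; lra.
Qed.

End Barycentric.

Section Decomposition.
Local Open Scope classical_set_scope.
Local Open Scope ring_scope.
Variables (R : realType) (m : nat).
Local Notation n := m.*2.+1.
Implicit Types (x y : 'rV[R]_n) (i j : 'I_n).
Hypothesis m_gt0 : (0 < m)%N.
Local Notation vtx := (@vtx R m).
Local Notation bary := (@bary R m).

Lemma bary_segment x y (t : R) k :
  bary ((1 - t) *: x + t *: y) k = (1 - t) * bary x k + t * bary y k.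
Proof. by rewrite /bary !mxE; ring. Qed.

Lemma bary_const x c k : bary (x + const_mx c) k = bary x k.
Proof. by rewrite /bary !mxE; ring. Qed.

Lemma bary_sum (I : finType) (c : I -> R) (w : I -> 'rV[R]_n) k :
  \sum_i c i = 1 -> bary (\sum_i c i *: w i) k = \sum_i c i * bary (w i) k.
Proof.
move=> c1; rewrite /bary.
under [in RHS]eq_bigr do rewrite mulrCA; rewrite -mulr_sumr; congr (_ * _).
under [in RHS]eq_bigr do rewrite mulrDr mulrBr.
rewrite big_split sumrB /= -mulr_suml c1 mul1r !summxE.
by congr (_ - _ + _); apply: eq_bigr => i _; rewrite mxE.
Qed.

Lemma bary_pos k x : (1 < k)%N -> (k <= m)%N ->
  bary x k = 2 * (x 0 (inord k) - x 0 (inord k.-1)).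
Proof.
move=> k1 km; rewrite /bary ltnNge k1 /= /wall_fst (_ : maxn k 1 = k); last by lia.
by rewrite /wall_snd (_ : k == 0%N = false) ?addr0 //; lia.
Qed.

Lemma bary0 x : bary x 0 = x 0 (inord 1) - x 0 ord_max + 1.
Proof. by rewrite /bary /wall_fst /wall_snd /= max0n mul1r. Qed.

Lemma bary1 x : bary x 1 = x 0 (inord 1) - x 0 ord0.
Proof.
rewrite /bary /wall_fst /wall_snd /= maxnn mul1r addr0.
by congr (_ - x 0 _); apply: ord_inj; rewrite inordK.
Qed.

Lemma rev_ord0 : rev_ord (ord0 : 'I_n) = ord_max.
Proof. by apply: ord_inj; rewrite val_rev_ord /= subn0. Qed.

(** The coefficients 1, 1, 2, ..., 2 in [bary] are the marks of the affine Dynkin diagram of type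
    B_m. The sum telescopes to 2 x_mid - x_0 - x_max + 1, and the equation of the apartment makes
    this 1. *)
Lemma sum_bary x : apartment x -> \sum_(k < m.+1) bary x k = 1.
Proof.
move=> ax; rewrite -(big_mkord xpredT (bary x)) big_ltn // big_ltn //.
rewrite (eq_big_nat _ _ (F2 := fun k => 2 * (x 0 (inord k) - x 0 (inord k.-1)))); last first.
  by move=> k /andP[k2 km]; rewrite bary_pos.
rewrite big_add1 /= -mulr_sumr telescope_sumr // bary0 bary1.
have := ax ord0; rewrite rev_ord0 /mid; lra.
Qed.

Lemma bary_decomp x : apartment x ->
  x = \sum_(k < m.+1) bary x k *: vtx k + const_mx (x 0 (mid m)).
Proof.
move=> ax; set y := (X in _ = X + _).
have yE j : y 0 j = \sum_(k < m.+1) bary x k * vtx k 0 j.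
  by rewrite /y summxE; apply: eq_bigr => k _; rewrite mxE.
have yN j : y 0 (rev_ord j) = - y 0 j.
  rewrite !yE -sumrN; apply: eq_bigr => k _.
  by rewrite vtx_rev ?mulrN //; have := ltn_ord k; lia.
(* For j < m only the vertices of index k > j have a nonzero entry at j. It is -1/2, or -1 for k =
   1, and so cancels the coefficient in [bary] up to sign; what remains telescopes from j to m. *)
have y_lo j : (j < m)%N -> y 0 j = x 0 j - x 0 (mid m).
  move=> jm; rewrite yE -(big_mkord xpredT (fun k => bary x k * vtx k 0 j)).
  rewrite (big_cat_nat (n := j.+1)) //=; last by lia.
  rewrite big_nat big1 ?add0r => [|k /andP[_ kj]]; last first.
    rewrite vtxE; [|lia..].
    case: (k =P 1%N) => k1; first by rewrite !ifF ?mulr0 //; lia.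
    by rewrite ifF ?ifT ?mulr0 //; lia.
  rewrite (eq_big_nat _ _ (F2 := fun k => - (x 0 (inord k) - x 0 (inord k.-1)))).
    rewrite sumrN big_add1 /= telescope_sumr; last by lia.
    by rewrite inord_val opprB.
  move=> k /andP[jk km]; rewrite vtxE; [|lia..].
  case: (k =P 1%N) => k1.
    rewrite k1 bary1 ifT; last by lia.
    by rewrite mulrN1 /=; congr (- (_ - x 0 _)); apply: ord_inj; rewrite inordK.
  rewrite ifT // bary_pos; [|lia..].
  by rewrite mulrN; field.
apply/rowP => j; rewrite !mxE.
have [/y_lo -> |jm] := ltnP j m; first by ring.
have [jm'|jm'] := eqVneq (j : nat) m.
  have -> : j = mid m by apply: ord_inj; rewrite val_mid.
  by have := yN (mid m); rewrite rev_mid; lra.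
have := y_lo (rev_ord j); rewrite val_rev_ord yN.
move=> /(_ ltac:(have := ltn_ord j; lia)).
have := ax j; lra.
Qed.

Lemma vtx_inj (i k : nat) : (i <= m)%N -> (k <= m)%N -> vtx i = vtx k -> i = k.
Proof.
move=> im km ik; have := bary_vtx R m_gt0 im km; rewrite ik bary_vtx // eqxx.
by case: (i =P k) => // _ /esym/eqP; rewrite eq_sym oner_eq0.
Qed.

Definition closed_alcove : set 'rV[R]_n :=
  [set x | apartment x /\ forall k, (k <= m)%N -> 0 <= bary x k].

Lemma closed_alcove_diff x i j : apartment x ->
  x 0 i - x 0 j = \sum_(k < m.+1) bary x k * (vtx k 0 i - vtx k 0 j).
Proof.
move=> /bary_decomp xE; rewrite {1 2}xE !mxE !summxE opprD addrACA subrr addr0.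
rewrite -sumrB; apply: eq_bigr => k _.
by rewrite !mxE mulrBr.
Qed.

Lemma closed_alcove_bound x i j : closed_alcove x -> (i < j)%N ->
  j != rev_ord i -> -1 <= x 0 i - x 0 j <= 0.
Proof.
move=> [ax b0] ij jri; rewrite closed_alcove_diff //.
have bd (k : 'I_m.+1) : -1 <= vtx k 0 i - vtx k 0 j <= 0.
  by apply: vtx_bound => //; have := ltn_ord k.
apply/andP; split.
  rewrite -[X in - X](sum_bary ax) -sumrN; apply: ler_sum => k _.
  have := b0 k ltac:(have := ltn_ord k; lia).
  by have /andP[] := bd k; nra.
apply: sumr_le0 => k _.
have := b0 k ltac:(have := ltn_ord k; lia).
by have /andP[] := bd k; nra.
Qed.

(* By [closed_alcove_bound], x_i - x_j = d meets the closed alcove only for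
   d = 0 and d = -1, where it cuts out a face. *)
Lemma closed_alcove_wall x i j k (e : R) : closed_alcove x -> (i < j)%N ->
  j != rev_ord i -> (e = 0 \/ e = -1) -> x 0 i - x 0 j = e ->
  (k <= m)%N -> 0 < bary x k -> vtx k 0 i - vtx k 0 j = e.
Proof.
move=> [ax b0] ij jri e01 xe km bk.
have bd (l : 'I_m.+1) : -1 <= vtx l 0 i - vtx l 0 j <= 0.
  by apply: vtx_bound => //; have := ltn_ord l.
have b0' (l : 'I_m.+1) : 0 <= bary x l by apply: b0; have := ltn_ord l.
have S0 : \sum_(l < m.+1) bary x l * (vtx l 0 i - vtx l 0 j - e) = 0.
  under eq_bigr do rewrite mulrBr.
  by rewrite sumrB -closed_alcove_diff // -mulr_suml sum_bary // xe mul1r subrr.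
have km' : (k < m.+1)%N by [].
have term : bary x k * (vtx k 0 i - vtx k 0 j - e) = 0.
  case: e01 => eE; rewrite eE in S0 *.
    have := S0; under eq_bigr do rewrite subr0.
    move=> /eqP; rewrite -oppr_eq0 -sumrN psumr_eq0 => [/allP|l _]; last first.
      by rewrite -mulrN mulr_ge0 //; have /andP[] := bd l; lra.
    move=> /(_ (Ordinal km') (mem_index_enum _)) /=.
    by rewrite oppr_eq0 => /eqP H0; rewrite subr0.
  move/eqP: S0; rewrite psumr_eq0 => [/allP|l _]; last first.
    by rewrite mulr_ge0 //; have /andP[] := bd l; lra.
  by move=> /(_ (Ordinal km') (mem_index_enum _)) /= /eqP.
by move/eqP: term; rewrite mulf_eq0 gt_eqF //= subr_eq0 => /eqP.
Qed.

End Decomposition.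

(** * Facets *)

Section Facets.
Local Open Scope classical_set_scope.
Local Open Scope ring_scope.
Variables (R : realType) (m : nat).
Local Notation n := m.*2.+1.
Implicit Types (x y z : 'rV[R]_n) (i j : 'I_n) (k : nat).
Hypothesis m_gt0 : (0 < m)%N.
Local Notation vtx := (@vtx R m).
Local Notation bary := (@bary R m).
Local Notation closed_alcove := (@closed_alcove R m).

Definition facet_of z : set 'rV[R]_n := [set y | apartment y /\ same_facet z y].

Lemma same_facet_const x c : same_facet x (x + const_mx c).
Proof. by move=> i j d _ _; rewrite !mxE; congr Num.sg; ring. Qed.

Lemma facet_of_eq x y : same_facet x y -> facet_of x = facet_of y.
Proof.
move=> xy; apply/seteqP; split=> z [az xz]; split=> // i j d ji jri.
  by rewrite -xy // xz.
by rewrite xy // xz.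
Qed.

Lemma mem_facet_of x : apartment x -> facet_of x x.
Proof. by move=> ax; split. Qed.

Lemma facet_facet_of x : apartment x -> facet (facet_of x).
Proof. by move=> ax; exists x. Qed.

Lemma sg_bary x y k : (k <= m)%N -> same_facet x y ->
  Num.sg (bary x k) = Num.sg (bary y k).
Proof.
move=> km xy; rewrite /bary !sgrM; congr (_ * _).
have := xy _ _ (- (k == 0%N)%:Z) (wall_neq m_gt0 km) (wall_neq_rev m_gt0 km).
by rewrite rmorphN /= !opprK.
Qed.

(** A hyperplane with value 0 or -1 through [x] contains every vertex in the support of [x], hence
    every point whose support is contained in that of [x]. *)
Lemma wall_transfer x y i j (e : R) : closed_alcove x -> closed_alcove y ->
  (forall k, (k <= m)%N -> 0 < bary y k -> 0 < bary x k) ->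
  (i < j)%N -> j != rev_ord i -> (e = 0 \/ e = -1) ->
  x 0 i - x 0 j = e -> y 0 i - y 0 j = e.
Proof.
move=> cx [ay y0] yx ij jri e01 xe.
rewrite (closed_alcove_diff m_gt0) // -[RHS]mul1r -(sum_bary m_gt0 ay) mulr_suml.
apply: eq_bigr => k _; have km : (k <= m)%N by have := ltn_ord k; lia.
have := y0 k km; rewrite le0r => /predU1P[-> |yk]; first by rewrite !mul0r.
congr (_ * _).
exact: (closed_alcove_wall m_gt0 cx ij jri e01 xe km (yx k km yk)).
Qed.

Lemma same_facet_support x y : closed_alcove x -> closed_alcove y ->
  (forall k, (k <= m)%N -> (0 < bary x k) = (0 < bary y k)) -> same_facet x y.
Proof.
move=> cx cy xy.
have key i j (d : int) : (i < j)%N -> j != rev_ord i ->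
    Num.sg (x 0 i - x 0 j - d%:~R) = Num.sg (y 0 i - y 0 j - d%:~R).
  move=> ij jri.
  have T e (e01 : e = 0 \/ e = -1) : (x 0 i - x 0 j == e) = (y 0 i - y 0 j == e).
    apply/eqP/eqP; apply: (wall_transfer _ _ _ ij jri e01) => // k km.
      by rewrite xy.
    by rewrite xy.
  have := closed_alcove_bound m_gt0 cx ij jri.
  have := closed_alcove_bound m_gt0 cy ij jri.
  have := T 0 ltac:(by left); have := T (-1) ltac:(by right).
  move: (x 0 i - x 0 j) (y 0 i - y 0 j) => a b Tm T0 /andP[b1 b2] /andP[a1 a2].
  (* For d >= 1 or d <= -2 the whole closed alcove lies strictly on one side. For d = 0 or -1 it
     lies weakly on one side, and [T] decides whether the point is on the hyperplane. *)
  have [d0|d0] := lerP 1 d.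
    have : 1 <= d%:~R :> R by rewrite (ler_int R 1).
    by move=> d1; rewrite !ltr0_sg //; lra.
  have [d2|d2] := lerP d (-2).
    have : d%:~R <= (-2)%:~R :> R by rewrite ler_int.
    by rewrite rmorphN /= => d3; rewrite !gtr0_sg //; lra.
  have [->|->] : d = 0 \/ d = -1 by lia.
    rewrite !subr0; have [a0|a0] := eqVneq a 0.
      by move: T0; rewrite a0 eqxx => /esym/eqP ->.
    have b0 : b != 0 by rewrite -T0.
    by rewrite !ltr0_sg // lt_neqAle ?a0 ?b0 ?a2 ?b2.
  rewrite rmorphN /= opprK; have [a0|a0] := eqVneq a (-1).
    by move: Tm; rewrite a0 eqxx => /esym/eqP ->.
  have b0 : b != -1 by rewrite -Tm.
  by rewrite !gtr0_sg // -[X in _ + X]opprK subr_gt0 lt_neqAle eq_sym ?a0 ?b0 ?a1 ?b1.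
move=> i j d; rewrite -(inj_eq (@ord_inj _)) => ji jri.
have [ij|ji'] := ltnP i j; first exact: key.
have E w : Num.sg (w 0 i - w 0 j - d%:~R) = - Num.sg (w 0 j - w 0 i - (- d)%:~R) :> R.
  by rewrite -sgrN rmorphN /=; congr Num.sg; ring.
rewrite !E key //; first by lia.
by apply: contra jri => /eqP ->; rewrite rev_ordK.
Qed.

Lemma facet_ofP z : closed_alcove z -> forall y, facet_of z y <->
  closed_alcove y /\ forall k, (k <= m)%N -> (0 < bary z k) = (0 < bary y k).
Proof.
move=> cz y; split=> [[ay zy]|[cy zy]]; last first.
  by split; [case: cy | exact: same_facet_support].
have S k km := sg_bary (k := k) km zy.
split=> [|k km]; last by rewrite -sgr_gt0 S // sgr_gt0.
by split=> // k km; rewrite -sgr_ge0 -S // sgr_ge0; case: cz => _; apply.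
Qed.

Lemma apartment_comb (I : finType) (c : I -> R) (w : I -> 'rV[R]_n) :
  (forall k : I, apartment (w k)) -> apartment (\sum_(k : I) c k *: w k).
Proof.
move=> aw i; rewrite !summxE -big_split mulr_sumr; apply: eq_bigr => k _ /=.
by rewrite !mxE -mulrDr aw mulrCA.
Qed.

Lemma apartment_segment x y (t : R) : apartment x -> apartment y ->
  apartment ((1 - t) *: x + t *: y).
Proof.
move=> ax ay i; rewrite !mxE; move: (ax i) (ay i) => e1 e2.
have -> : x 0 (rev_ord i) = 2 * x 0 (mid m) - x 0 i by lra.
have -> : y 0 (rev_ord i) = 2 * y 0 (mid m) - y 0 i by lra.
by ring.
Qed.

Lemma apartment_const x c : apartment x -> apartment (x + const_mx c).
Proof. by move=> ax i; rewrite !mxE addrACA ax; ring. Qed.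

Lemma closure_apartment (S : set 'rV[R]_n) :
  S `<=` apartment (m := m) -> closure S `<=` apartment (m := m).
Proof.
move=> SA x Sx i.
have cx j : continuous (fun y : 'rV[R]_n => y 0 j) by exact: coord_continuous.
pose f (y : 'rV[R]_n) := y 0 i + y 0 (rev_ord i) - 2 * y 0 (mid m).
have cf : continuous f.
  move=> y; refine (cvgB (cvgD (cx i y) (cx (rev_ord i) y)) _).
  exact: (cvgM (cvg_cst _) (cx (mid m) y)).
have fS y : S y -> f y = 0 by move=> /SA ay; rewrite /f ay subrr.
have f0 : 0 <= f x by apply: (closure_ge0 cf _ Sx) => y /fS ->.
have : 0 <= - f x.
  apply: (closure_ge0 (f := fun y => - f y) _ _ Sx) => [y|y /fS ->].
    exact: (cvgN (cf y)).
  by rewrite oppr0.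
by move: f0; rewrite /f; lra.
Qed.

Lemma continuous_bary k : continuous (bary^~ k).
Proof.
have cx j : continuous (fun y : 'rV[R]_n => y 0 j) by exact: coord_continuous.
move=> x; have cc (c : R) : (fun=> c) @ nbhs x --> c by exact: cvg_cst.
exact: (cvgM (cc _) (cvgD (cvgB (cx (wall_fst m k) x) (cx (wall_snd m k) x)) (cc _))).
Qed.

Lemma bary_gt0_base_alcove x : apartment x ->
  (forall k, (k <= m)%N -> 0 < bary x k) -> base_alcove x.
Proof.
move=> ax b0; split=> //.
- by have := b0 1 m_gt0; rewrite bary1; lra.
- by have := b0 0 isT; rewrite bary0; lra.
- move=> i j i0 ij jm.
  have key k : (i < k)%N -> (k <= m)%N -> x 0 i < x 0 (inord k).
    elim: k => // k IHk ik km.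
    have := b0 k.+1 km; rewrite bary_pos //=; last by lia.
    have [ik'|ki] := ltnP i k; first by have := IHk ik' (ltnW km); lra.
    have -> : inord k = i by apply: ord_inj; rewrite inordK; lia.
    by lra.
  by have := key j ij jm; rewrite inord_val.
Qed.

Lemma base_alcove_bary_gt0 x k : base_alcove x -> (k <= m)%N -> 0 < bary x k.
Proof.
move=> [ax x01 xm1 xs]; case: k => [|[|k]] km.
- by rewrite bary0; lra.
- by rewrite bary1; lra.
- rewrite bary_pos //= mulr_gt0 // subr_gt0; apply: xs; rewrite !inordK; lia.
Qed.

Lemma closed_alcove_closure (S : set 'rV[R]_n) :
  S `<=` closed_alcove -> closure S `<=` closed_alcove.
Proof.
move=> Sc x Sx; split=> [|k km].
  by apply: (closure_apartment _ Sx) => y /Sc[].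
by apply: (closure_ge0 (@continuous_bary k) _ Sx) => y /Sc[_]; exact.
Qed.

Definition barycenter (J : {set 'I_m.+1}) : 'rV[R]_n :=
  \sum_(k < m.+1) ((k \in J)%:R / #|J|%:R) *: vtx k.

Lemma barycenter_apartment J : apartment (barycenter J).
Proof.
by apply: apartment_comb => k; apply: vtx_apartment; have := ltn_ord k; lia.
Qed.

Lemma bary_barycenter J (k : 'I_m.+1) : J != finset.set0 ->
  bary (barycenter J) k = (k \in J)%:R / #|J|%:R.
Proof.
move=> J0; have c1 : \sum_(i < m.+1) ((i \in J)%:R / #|J|%:R) = 1 :> R.
  rewrite -mulr_suml -natr_sum -big_mkcond /= sum1_card divff //.
  by rewrite pnatr_eq0 -lt0n card_gt0.
have km (i : 'I_m.+1) : (i <= m)%N by have := ltn_ord i; lia.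
rewrite bary_sum // (bigD1 k) //= bary_vtx // eqxx mulr1 big1 ?addr0 // => i ik.
by rewrite -(inj_eq (@ord_inj _)) in ik; rewrite bary_vtx // (negPf ik) mulr0.
Qed.

Lemma closure_base_alcove : closure (base_alcove (m := m)) = closed_alcove.
Proof.
apply/seteqP; split.
  apply: closed_alcove_closure => x bx; split; first by case: bx.
  by move=> k km; apply/ltW/base_alcove_bary_gt0.
move=> x [ax x0]; apply: (@closure_segment _ _ _ x (barycenter finset.setT)) => t /andP[t0 t1].
apply: bary_gt0_base_alcove; first exact/apartment_segment/barycenter_apartment.
move=> k km; rewrite bary_segment.
have km' : (k < m.+1)%N by [].
have T0 : finset.setT != finset.set0 :> {set 'I_m.+1}.
  by apply/set0Pn; exists ord0; rewrite inE.
rewrite (bary_barycenter (Ordinal km') T0) inE mul1r.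
apply: ltr_wpDl; first by rewrite mulr_ge0 ?x0 // subr_ge0.
by rewrite mulr_gt0 // invr_gt0 ltr0n card_gt0.
Qed.

End Facets.

(** * The facet F_I and its vertices *)

Section SubfacetFI.
Local Open Scope classical_set_scope.
Local Open Scope ring_scope.
Variables (R : realType) (m : nat).
Local Notation n := m.*2.+1.
Implicit Types (a v x y z : 'rV[R]_n) (i j : 'I_n) (k : nat) (I : {set 'I_m.+1}).
Hypothesis m_gt0 : (0 < m)%N.
Local Notation vtx := (@vtx R m).
Local Notation bary := (@bary R m).
Local Notation closed_alcove := (@closed_alcove R m).
Local Notation facet_of := (@facet_of R m).
Local Notation barycenter := (@barycenter R m).

Lemma lineP a y : line a y <-> forall j, y 0 j - y 0 (mid m) = a 0 j - a 0 (mid m).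
Proof.
split=> [[c _ <-] j|ya]; first by rewrite !mxE; ring.
exists (y 0 (mid m) - a 0 (mid m)) => //; apply/rowP => j; rewrite !mxE.
by have := ya j; lra.
Qed.

Lemma closure_line a : closure (line a) `<=` line a.
Proof.
have cx j : continuous (fun y : 'rV[R]_n => y 0 j) by exact: coord_continuous.
move=> y ay; apply/lineP => j.
have cf (s : R) : continuous (fun y : 'rV[R]_n =>
    s * (y 0 j - y 0 (mid m) - (a 0 j - a 0 (mid m)))).
  move=> z; have cc (c : R) : (fun=> c) @ nbhs z --> c by exact: cvg_cst.
  exact: (cvgM (cc s) (cvgB (cvgB (cx j z) (cx (mid m) z)) (cc _))).
have p : 0 <= 1 * (y 0 j - y 0 (mid m) - (a 0 j - a 0 (mid m))).
  by apply: (closure_ge0 (cf 1) _ ay) => z /lineP ->; rewrite subrr mulr0.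
have q : 0 <= -1 * (y 0 j - y 0 (mid m) - (a 0 j - a 0 (mid m))).
  by apply: (closure_ge0 (cf (-1)) _ ay) => z /lineP ->; rewrite subrr mulr0.
by move: p q; lra.
Qed.

Lemma closed_alcove_vtx k : (k <= m)%N -> closed_alcove (vtx k).
Proof.
move=> km; split; first exact: vtx_apartment.
by move=> i im; rewrite bary_vtx // ler0n.
Qed.

Lemma facet_of_vtx k : (k <= m)%N -> facet_of (vtx k) = line (vtx k).
Proof.
move=> km; apply/seteqP; split=> y; last first.
  move=> [c _ <-]; split; last exact: same_facet_const.
  exact/apartment_const/vtx_apartment.
move=> /(facet_ofP m_gt0 (closed_alcove_vtx km))[[ay y0] yk].
have km' : (k < m.+1)%N by [].
have yi (i : 'I_m.+1) : i != Ordinal km' -> bary y i = 0.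
  rewrite -(inj_eq (@ord_inj _)) /= eq_sym => ik; have im : (i <= m)%N by have := ltn_ord i; lia.
  have := yk i im; rewrite bary_vtx // (negPf ik) ltxx => /esym/negbT.
  by rewrite -leNgt => yi; apply/eqP; rewrite eq_le yi y0.
have := sum_bary m_gt0 ay; rewrite (bigD1 (Ordinal km')) //= big1 ?addr0 // => yk1.
exists (y 0 (mid m)) => //; rewrite [RHS](bary_decomp m_gt0 ay).
rewrite (bigD1 (Ordinal km')) //= yk1 scale1r big1 ?addr0 // => i /yi ->.
by rewrite scale0r.
Qed.

Lemma line_sub_closure z k : closed_alcove z -> (k <= m)%N -> 0 < bary z k ->
  line (vtx k) `<=` closure (facet_of z).
Proof.
move=> cz km zk _ [c _ <-].
apply: (@closure_segment _ _ _ _ z) => t /andP[t0 t1].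
have bE (i : nat) : (i <= m)%N -> bary ((1 - t) *: (vtx k + const_mx c) + t *: z) i =
    (1 - t) * (k == i)%:R + t * bary z i.
  by move=> im; rewrite bary_segment bary_const bary_vtx.
have [az z0] := cz; apply/facet_ofP => //; split.
  split; first exact/apartment_segment/az/apartment_const/vtx_apartment.
  by move=> i im; rewrite bE // addr_ge0 // mulr_ge0 ?z0 ?ler0n //; lra.
move=> i im; rewrite bE //; have [<-|ki] := eqVneq k i.
  rewrite zk mulr1; symmetry; apply: ltr_wpDl; first by lra.
  by rewrite mulr_gt0.
by rewrite mulr0 add0r (pmulr_rgt0 _ t0).
Qed.

Lemma facet_line_vtx k : (k <= m)%N -> facet (line (vtx k)).
Proof.
by move=> km; rewrite -facet_of_vtx //; apply/facet_facet_of/vtx_apartment.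
Qed.

(** Facets are stable under translation along (1,...,1), so a facet contained in the closed set
    [line (vtx k)] is the whole line. *)
Lemma line_minimal_subfacet z k : closed_alcove z -> (k <= m)%N ->
  0 < bary z k -> minimal_subfacet (m := m) (line (vtx k)) (facet_of z).
Proof.
move=> cz km zk; split.
  by split; [exact: facet_line_vtx|exact: line_sub_closure].
move=> F' [[x ax ->] F'l]; rewrite -/(facet_of x).
have [c _ xE] : line (vtx k) x.
  by apply/closure_line/F'l; exact: mem_facet_of.
by rewrite -(facet_of_vtx km) -xE; symmetry; apply/facet_of_eq/same_facet_const.
Qed.

Lemma line_inj (i k : nat) : (i <= m)%N -> (k <= m)%N -> line (vtx i) = line (vtx k) -> i = k.
Proof.
move=> im km ik; apply: (vtx_inj (R := R) m_gt0) => //.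
have : line (vtx k) (vtx i) by rewrite -ik; exists 0; rewrite // raddf0 addr0.
move=> /lineP E; apply/rowP => j; have := E j; rewrite !vtx_mid //; lra.
Qed.

Lemma FI_vertexP I a : FI_vertex I a <-> exists2 k : 'I_m.+1, k \in I & a = vtx k.
Proof.
have i1 : (inord 1 : 'I_m.+1) = 1%N :> nat by rewrite inordK.
split=> [[[k [kI k1 ->]]|[I1 ->]]|[k kI ->]].
- by exists k; rewrite // /vtx (negPf k1).
- by exists (inord 1); rewrite // /vtx i1.
- rewrite /vtx; have [k1|k1] := eqVneq (k : nat) 1%N; last by left; exists k.
  by right; split=> //; rewrite (_ : inord 1 = k) //; apply: ord_inj; rewrite i1.
Qed.

(** Each vertex in the support of [v] spans a line that is a minimal subfacet of the facet of [v],
    so the characterisation of F_I puts its index in [I]. *)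
Lemma FI_support I v : FI I v -> closed_alcove v /\
  forall k : 'I_m.+1, 0 < bary v k -> k \in I.
Proof.
move=> [F [[[z az ->] zcl] minF] Fv].
have cv : closed_alcove v by rewrite -closure_base_alcove //; exact: zcl.
have E : facet_of z = facet_of v by case: Fv => _; exact: facet_of_eq.
split=> // k vk; have km (i : 'I_m.+1) : (i <= m)%N by have := ltn_ord i; lia.
have := line_minimal_subfacet cv (km k) vk; rewrite -E => /minF[a /FI_vertexP[i iI ->]].
by move=> /line_inj ki; rewrite (_ : k = i) //; apply: ord_inj; exact: ki.
Qed.

Lemma closed_alcove_barycenter I : I != finset.set0 -> closed_alcove (barycenter I).
Proof.
move=> I0; split; first exact: barycenter_apartment.
move=> k km; have km' : (k < m.+1)%N by [].
by rewrite (bary_barycenter R m_gt0 (Ordinal km') I0) divr_ge0 ?ler0n.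
Qed.

Lemma bary_barycenter_gt0 I (k : 'I_m.+1) : I != finset.set0 ->
  (0 < bary (barycenter I) k) = (k \in I).
Proof.
move=> I0; rewrite bary_barycenter //; case: (k \in I); last by rewrite mul0r ltxx.
by rewrite mul1r invr_gt0 ltr0n card_gt0.
Qed.

Lemma closed_alcove_bary_gt0 z : closed_alcove z ->
  exists k : 'I_m.+1, 0 < bary z k.
Proof.
move=> [az z0]; apply: contrapT => /forallNP nz.
have := sum_bary m_gt0 az; rewrite big1 => [/esym/eqP|k _]; first by rewrite oner_eq0.
apply/eqP; rewrite eq_le z0 ?andbT; last by have := ltn_ord k; lia.
by rewrite leNgt; apply/negP.
Qed.

Lemma is_FI_barycenter I : I != finset.set0 -> is_FI I (facet_of (barycenter I)).
Proof.
move=> I0; have cI := closed_alcove_barycenter I0; have [aI _] := cI.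
have km (i : 'I_m.+1) : (i <= m)%N by have := ltn_ord i; lia.
have sub : facet_of (barycenter I) `<=` closed_alcove by move=> y /(facet_ofP m_gt0 cI)[].
split; first by split; [exact: facet_facet_of|rewrite closure_base_alcove].
move=> L; split=> [[[[z az ->] zcl] minL]|[a /FI_vertexP[k kI ->] ->]]; last first.
  by apply: line_minimal_subfacet => //; rewrite bary_barycenter_gt0.
rewrite -/(facet_of z) in zcl minL *.
have zc := zcl _ (mem_facet_of az).
have cz : closed_alcove z := closed_alcove_closure sub zc.
(* The coordinates sum to 1, so one is positive; the line through that vertex is a subfacet of
   [facet_of z], and minimality identifies the two. *)
have [k zk] := closed_alcove_bary_gt0 cz.
exists (vtx k); last first.
  symmetry; apply: minL; split; first exact: facet_line_vtx.
  exact: line_sub_closure.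
(* For k outside [I] the k-th coordinate is nonpositive on the facet of the barycentre, hence also
   at the point [z] of its closure. *)
apply/FI_vertexP; exists k => //; apply: contraLR zk => kI.
rewrite -leNgt -oppr_ge0.
apply: (closure_ge0 (f := fun y => - bary y k) _ _ zc) => [y|y].
  exact: (cvgN (@continuous_bary R m k y)).
move=> /(facet_ofP m_gt0 cI)[_ /(_ k (km k))].
by rewrite bary_barycenter_gt0 // (negPf kI) oppr_ge0 leNgt => <-.
Qed.

(** For t > 0 the support is exactly [I], even though the endpoint [vtx k] itself may lie outside
    F_I. *)
Lemma FI_segment I (k : 'I_m.+1) (t : R) : I != finset.set0 -> k \in I -> 0 < t <= 1 ->
  FI I ((1 - t) *: vtx k + t *: barycenter I).
Proof.
move=> I0 kI /andP[t0 t1]; exists (facet_of (barycenter I)); first exact: is_FI_barycenter.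
have cI := closed_alcove_barycenter I0; have [aI c0] := cI.
have km (i : 'I_m.+1) : (i <= m)%N by have := ltn_ord i; lia.
apply/facet_ofP => //; split.
  split; first exact/apartment_segment/aI/vtx_apartment.
  move=> i im; rewrite bary_segment bary_vtx // addr_ge0 // mulr_ge0 ?ler0n ?c0 //; lra.
move=> i im; rewrite bary_segment bary_vtx //.
have im' : (i < m.+1)%N by [].
have [<-|ki] := eqVneq (k : nat) i; last by rewrite mulr0 add0r (pmulr_rgt0 _ t0).
rewrite mulr1 bary_barycenter_gt0 // kI; symmetry; apply: ltr_wpDl; first by lra.
by rewrite mulr_gt0 // bary_barycenter_gt0.
Qed.

End SubfacetFI.

(** * Displacement vectors *)

Section Displacement.
Local Open Scope classical_set_scope.
Local Open Scope ring_scope.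
Variables (R : realType) (m : nat).
Local Notation n := m.*2.+1.
Implicit Types (a b v : 'rV[R]_n) (x y : affperm n) (j : 'I_n) (k : nat).
Local Notation vtx := (@vtx R m).
Local Notation bary := (@bary R m).
Local Notation polytope := (@polytope R m).

Lemma le_segment_limit (a b c : R) :
  (forall t, 0 < t <= 1 -> (1 - t) * a + t * b <= c) -> a <= c.
Proof.
move=> abc; rewrite leNgt; apply/negP => ca.
(* Adding a - c makes K positive and t at most 1. As t K = (a - c)/2, the value at t is at least a -
   t |b - a|, which exceeds c. *)
pose K := `|b - a| + (a - c).
have ba0 : 0 <= `|b - a| := normr_ge0 _.
have K0 : 0 < K by rewrite /K; lra.
pose t := (a - c) / (2 * K).
have tK : t * K = (a - c) / 2 by rewrite /t; field; rewrite gt_eqF.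
have t0 : 0 < t by rewrite divr_gt0 //; lra.
have t1 : t <= 1 by rewrite ler_pdivrMr /K; lra.
have := abc t; rewrite t0 t1 => /(_ isT).
have : - (b - a) <= `|b - a| by rewrite -normrN ler_norm.
by move: tK; rewrite /K; nra.
Qed.

Definition displ x v : 'rV[R]_n := aact x v - v.

Lemma displE x v j : displ x v 0 j = (x.1 0 j)%:~R + v 0 (x.2^-1%g j) - v 0 j.
Proof. by rewrite !mxE. Qed.

Lemma displ_segment x a b t :
  displ x ((1 - t) *: a + t *: b) = (1 - t) *: displ x a + t *: displ x b.
Proof. by apply/rowP => j; rewrite !mxE; ring. Qed.

Definition half_integral v := forall j, exists z : int, 2 * v 0 j = z%:~R.

Lemma vtx_half_integral k : (k <= m)%N -> half_integral (vtx k).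
Proof.
move=> km j; rewrite vtxE //; case: ifP => _.
  case: ifP => _; first by exists (-2); rewrite rmorphN /=; lra.
  by case: ifP => _; [exists 2; lra|exists 0; lra].
case: ifP => _; first by exists (-1); rewrite rmorphN /=; lra.
by case: ifP => _; [exists 0; lra|exists 1; rewrite rmorph1; lra].
Qed.

Lemma displ_half_integral x v : half_integral v -> half_integral (displ x v).
Proof.
move=> hv j; have [z1 e1] := hv (x.2^-1%g j); have [z2 e2] := hv j.
exists (2 * x.1 0 j + z1 - z2).
by rewrite displE rmorphB rmorphD rmorphM /= -e1 -e2; ring.
Qed.

Lemma displ_mul_fix (u x v : affperm n) a : aact u a = a -> aact v a = a ->
  displ (u * x * v)%g a = permv u.2 (displ x a).
Proof.
move=> ua va; rewrite /displ !aactM va -{2}ua.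
by rewrite [RHS]permvD permvN [aact u]/aact opprD addrACA subrr add0r.
Qed.

Lemma WI1 (I : {set 'I_m.+1}) : WI R I 1%g.
Proof.
split=> [|k _]; last by apply/rowP => j; rewrite !mxE invg1 perm1 add0r.
split; last by move=> i; rewrite !perm1.
split=> [i|i|]; rewrite ?mxE ?mulr0 //.
by rewrite big1 // => i _; rewrite mxE.
Qed.

Variable q : nat.

Lemma polytope_segment_limit a b :
  (forall t : R, 0 < t <= 1 -> polytope q ((1 - t) *: a + t *: b)) -> polytope q a.
Proof.
move=> P; have I1 : 0 < (1 : R) <= 1 by lra.
have I2 : 0 < (2^-1 : R) <= 1 by lra.
have [/sum_const2P b2 b02 bq] : polytope q b.
  by have := P 1 I1; rewrite subrr scale0r add0r scale1r.
split.
- apply/sum_const2P => j; have [/sum_const2P /(_ j) + _ _] := P _ I2.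
  by rewrite !mxE; have := b2 j; lra.
- move=> j; apply/andP; split; last first.
    apply: (@le_segment_limit _ (b 0 j)) => t /P[_ /(_ j)/andP[_ +] _].
    by rewrite !mxE.
  rewrite -oppr_le0; apply: (@le_segment_limit _ (- b 0 j)) => t /P[_ /(_ j)/andP[+ _] _].
  by rewrite !mxE; lra.
(* The reverse triangle inequality bounds (1-t)|a_j - 1| - t|b_j - 1| by the term of the segment
   point, hence the negative endpoint value. *)
- apply: (@le_segment_limit _ (- \sum_j `|b 0 j - 1|)) => t t01.
  have [_ _] := P t t01; apply: le_trans.
  rewrite mulrN !mulr_sumr -sumrB; apply: ler_sum => j _; rewrite !mxE.
  have t0 : 0 <= t by lra.
  have t1 : 0 <= 1 - t by lra.
  rewrite -{1}(ger0_norm t1) -{2}(ger0_norm t0) -!normrM.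
  apply: le_trans (lerB_normD _ _) _.
  by rewrite le_eqVlt; apply/orP; left; apply/eqP; congr (`|_|); ring.
Qed.

Lemma polytope_permv_iff s v : Sstar s -> polytope q (permv s v) <-> polytope q v.
Proof.
move=> Ss; split; last exact: polytope_permv.
by move/(polytope_permv (Sstar_inv Ss)); rewrite -permvM mulgV permv1.
Qed.

Hypothesis m_gt0 : (0 < m)%N.

(** The multiple of (1,...,1) in the barycentric decomposition is invariant under permutations and
    cancels in the displacement. *)
Lemma displ_bary x v : apartment v ->
  displ x v = \sum_(k < m.+1) bary v k *: displ x (vtx k).
Proof.
move=> av; apply/rowP => j; rewrite displE {1 2}(bary_decomp m_gt0 av) !mxE !summxE.
under [RHS]eq_bigr do rewrite mxE displE mulrBr mulrDr.
rewrite sumrB big_split /= -mulr_suml sum_bary // mul1r -!addrA; congr (_ + _).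
rewrite opprD [v 0 (mid m) + _]addrC subrK.
by congr (_ - _); apply: eq_bigr => k _; rewrite mxE.
Qed.

(** [WI] is defined through a_1, whereas [vtx 1] is a_{0'} = 2 a_1 - a_0; an affine map fixing a_0
    and a_1 fixes it as well. *)
Lemma WI_fix_vtx (I : {set 'I_m.+1}) x (k : 'I_m.+1) :
  (inord 1 \in I -> ord0 \in I) -> WI R I x -> k \in I -> aact x (vtx k) = vtx k.
Proof.
move=> I10 [_ fix_avec] kI; rewrite /vtx; case: eqP => k1; last exact: fix_avec.
have k1E : k = inord 1 by apply: ord_inj; rewrite inordK.
have E1 := fix_avec k kI; have E0 := fix_avec ord0 (I10 ltac:(by rewrite -k1E)).
apply/rowP => j; have /rowP/(_ j) := E1; have /rowP/(_ j) := E0; rewrite k1.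
rewrite !mxE /= !subn0.
have avec0'E (i : 'I_n) : (if i == ord0 then -1 else if i == ord_max then 1 else 0) =
    2 * (if (i < 1)%N then - 2^-1 else if (i < n - 1)%N then 0 else 2^-1) :> R.
  rewrite -[i == ord0](inj_eq (@ord_inj _)) -[i == ord_max](inj_eq (@ord_inj _)) /=.
  have := ltn_ord i => iN.
  case: (ltnP i 1) => i1; first by rewrite ifT; [lra|lia].
  rewrite ifF; last by lia.
  by case: (ltnP i (n - 1)) => i2; [rewrite ifF; [lra|lia]|rewrite ifT; [lra|lia]].
rewrite !avec0'E; have iN (i : 'I_n) := ltn_ord i.
by rewrite !iN addr0 => ->; rewrite !add0r => ->.
Qed.

(** Both factors fix the vertices in [I], the left one because I is contained in J. So the
    displacements are merely permuted by [u.2], under which the polytope is stable. *)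
Lemma double_coset_polytope (I J : {set 'I_m.+1}) (u x v : affperm n) :
  (inord 1 \in I -> ord0 \in I) -> (inord 1 \in J -> ord0 \in J) -> I \subset J ->
  WI R J u -> WI R I v ->
  (forall k : 'I_m.+1, k \in I -> polytope q (displ (u * x * v)%g (vtx k))) <->
  (forall k : 'I_m.+1, k \in I -> polytope q (displ x (vtx k))).
Proof.
move=> I10 J10 /fintype.subsetP IJ uW vW.
have Su : Sstar u.2 by case: uW => -[].
have E (k : 'I_m.+1) : k \in I -> displ (u * x * v)%g (vtx k) = permv u.2 (displ x (vtx k)).
  by move=> kI; apply: displ_mul_fix; [apply: WI_fix_vtx uW (IJ _ kI)|apply: WI_fix_vtx vW kI].
by split=> P k kI; have := P k kI; rewrite E // polytope_permv_iff.
Qed.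

Hypothesis qm : (q <= m)%N.

Lemma polytope_half_integral v : half_integral v -> polytope q v ->
  Conv_orbit (mu m q) v.
Proof.
move=> /choice[f fE] [/sum_const2P v2 v02 vq].
pose z : 'rV[int]_n := \row_j (f j - 2).
have zE j : (z 0 j)%:~R = 2 * (v 0 j - 1) :> R.
  by rewrite mxE rmorphB /= -fE; ring.
have -> : v = half_row R z by apply/rowP => j; rewrite [RHS]mxE zE; field.
have zN : skew_row z.
  move=> j; apply: (@intr_inj R); rewrite rmorphN /= !zE.
  by have := v2 j; lra.
apply: half_Conv => //.
  move=> j; have /andP[v0 vle] := v02 j.
  suff : -2 <= z 0 j <= 2 by rewrite (_ : ord0 = 0) //; lia.
  by rewrite -2!(ler_int R) zE rmorphN /=; apply/andP; split; lra.
have : (\sum_j absz (z 0%R j))%:R <= (2 * q.*2)%:R :> R.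
  apply: (@le_trans _ _ (2 * \sum_j `|v 0 j - 1|)); last first.
    by rewrite natrM ler_pM2l.
  rewrite natr_sum mulr_sumr; apply: ler_sum => j _.
  by rewrite natr_absz intr_norm zE normrM ger0_norm.
rewrite ler_nat sum_fold_sym => [|j]; last by rewrite zN abszN.
rewrite (_ : z 0 (mid m) = 0); last by have := zN (mid m); rewrite rev_mid; lia.
rewrite /half_sum addr0 (_ : ord0 = 0) // mulr2n -[_ + _]/(_ + _)%N.
by move: (bigop _ _ _) => S; rewrite /=; lia.
Qed.

Lemma FI_Conv_polytope (I : {set 'I_m.+1}) x : I != finset.set0 ->
  (forall v, FI I v -> Conv_orbit (mu m q) (displ x v)) <->
  (forall k : 'I_m.+1, k \in I -> polytope q (displ x (vtx k))).
Proof.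
move=> I0; have km (i : 'I_m.+1) : (i <= m)%N by have := ltn_ord i; lia.
split=> [C k kI|P v /(FI_support m_gt0)[[av v0] vI]].
  apply: (@polytope_segment_limit _ (displ x (barycenter R I))) => t t01.
  rewrite -displ_segment; apply: Conv_sub_polytope => //; apply: C.
  exact: FI_segment.
rewrite displ_bary //; apply: convex_sum.
- exact: Conv_orbit_convex.
- by move=> k; apply: v0.
- exact: sum_bary.
- move=> k vk; apply: polytope_half_integral; last exact/P/vI.
  exact/displ_half_integral/vtx_half_integral.
Qed.

End Displacement.

(** * The conditions at a vertex *)

Section EndRow.
Local Open Scope classical_set_scope.
Local Open Scope ring_scope.
Variables (R : realType) (m : nat).
Local Notation n := m.*2.+1.
Implicit Types (j : 'I_n) (b : 'rV[int]_n) (s : {perm 'I_n}).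
Local Notation vtx := (@vtx R m).

(** Since b_j and |b_j| have the same parity, half the l1-norm, which ignores the order of the
    entries, determines the parity that occurs in [Qvee]. *)
Lemma half_sum_parity b : skew_row b ->
  exists2 S : nat, (\sum_j absz (b 0%R j) = S.*2)%N &
    (2 %| \sum_(j : 'I_n | (j < m)%N) b 0 j - S%:Z)%Z.
Proof.
move=> bN; exists (\sum_(j : 'I_n | (j < m)%N) absz (b 0%R j))%N.
  rewrite sum_fold_sym => [|j]; last by rewrite bN abszN.
  rewrite (_ : b 0 (mid m) = 0); last by have := bN (mid m); rewrite rev_mid; lia.
  by rewrite addr0 mulr2n; exact: addnn.
rewrite -natz natr_sum -sumrB; apply: rpred_sum => j _.
rewrite natz; apply/dvdzP; have [bj|bj] : b 0 j = absz (b 0 j) \/ b 0 j = - (absz (b 0 j))%:Z by lia.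
  by exists 0; lia.
by exists (b 0 j); lia.
Qed.

Definition end_row : 'rV[int]_n :=
  \row_j (if j == ord0 then -1 else if j == ord_max then 1 else 0).

Lemma vtx1_end : vtx 1 = map_mx intr end_row.
Proof.
by apply/rowP => j; rewrite !mxE; do 2!case: ifP => _ //; rewrite rmorphN.
Qed.

Hypothesis m_gt0 : (0 < m)%N.

Lemma ord0_neq_max : (ord0 == ord_max :> 'I_n) = false.
Proof. by rewrite -(inj_eq (@ord_inj _)) /=; lia. Qed.

Lemma avec1_end : avec R m 1 = 2^-1 *: map_mx intr end_row.
Proof.
apply/rowP => j; rewrite !mxE.
rewrite -[j == ord0](inj_eq (@ord_inj _)) -[j == ord_max](inj_eq (@ord_inj _)) /=.
have jn := ltn_ord j; case: (ltnP j 1) => j1.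
  by rewrite ifT ?rmorphN ?mulrN1 //; lia.
rewrite [in RHS]ifF; last by lia.
by case: (ltnP j (n - 1)) => j2; [rewrite ifF ?mulr0 //; lia|rewrite ifT ?mulr1 //; lia].
Qed.

Lemma end_row_rev : skew_row end_row.
Proof.
move=> j; rewrite !mxE -{1}(rev_ordK ord0) -{1}(rev_ordK ord_max) !(inj_eq rev_ord_inj).
rewrite rev_ord0 -rev_ord0 rev_ordK rev_ord0.
have [->|j0] := eqVneq j ord0; first by rewrite ord0_neq_max.
by case: ifP.
Qed.

Lemma end_row_fix s : Sstar s -> s^-1%g ord0 = ord0 -> permv s end_row = end_row.
Proof.
move=> Ss s0; have smax : s^-1%g ord_max = ord_max.
  by rewrite -rev_ord0 (Sstar_inv Ss) s0.
apply/rowP => j; rewrite !mxE.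
by rewrite -{1}s0 -{1}smax !(inj_eq perm_inj).
Qed.

Lemma end_row_swap s : Sstar s -> s^-1%g ord0 = ord_max -> permv s end_row = - end_row.
Proof.
move=> Ss s0; have smax : s^-1%g ord_max = ord0.
  by rewrite -rev_ord0 (Sstar_inv Ss) s0 -rev_ord0 rev_ordK.
apply/rowP => j; rewrite !mxE.
have -> : (s^-1%g j == ord0) = (j == ord_max) by rewrite -smax (inj_eq perm_inj).
have -> : (s^-1%g j == ord_max) = (j == ord0) by rewrite -s0 (inj_eq perm_inj).
have [->|_] := eqVneq j ord0; first by rewrite ord0_neq_max opprK.
by case: ifP; rewrite ?oppr0.
Qed.

End EndRow.

Section SpinConditions.
Local Open Scope classical_set_scope.
Local Open Scope ring_scope.
Variables (R : realType) (m q : nat).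
Local Notation n := m.*2.+1.
Implicit Types (v : 'rV[R]_n) (x : affperm n) (j : 'I_n) (k : nat).
Implicit Types (b : 'rV[int]_n) (s : {perm 'I_n}).
Local Notation vtx := (@vtx R m).
Local Notation polytope := (@polytope R m).

Lemma half_odd_nint (z : int) : (z%:~R / 2 : R) \is a Num.int = (2 %| z)%Z.
Proof.
apply/intrP/idP => [[c cE]|/dvdzP[c ->]]; last by exists c; rewrite rmorphM /=; field.
apply/dvdzP; exists c; apply: (@intr_inj R); rewrite rmorphM /= -cE.
by field.
Qed.

(** This is where the quarter comes from. An opposite pair (0, 2) is counted once and (1/2, 3/2)
    contributes twice 1/4, so a pair contributes |v(j) - 1| in each case; the l1-sum has this term
    twice. *)
Lemma sp2_sum v : half_integral v -> sp1 v ->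
  sp2 q v <-> \sum_j `|v 0 j - 1| <= (q.*2)%:R.
Proof.
move=> hv [/sum_const2P v2 v02].
pose g (r : R) : R := (r == 2)%:R + 4^-1 * (r \isn't a Num.int)%:R.
have gE j : g (v 0 j) + g (v 0 (rev_ord j)) = `|v 0 j - 1|.
  have -> : v 0 (rev_ord j) = 2 - v 0 j by have := v2 j; lra.
  have [z zE] := hv j; have vE : v 0 j = z%:~R / 2 by rewrite -zE; field.
  have /andP[] := v02 j; have zle : 2 * v 0 j = z%:~R by [].
  move=> a1 a2; have : 0 <= z <= 4.
    by rewrite -2!(ler_int R) -zE; apply/andP; split; lra.
  rewrite /g vE (_ : 2 - z%:~R / 2 = (4 - z)%:~R / 2); last by rewrite rmorphB /=; field.
  rewrite !half_odd_nint => z04.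
  have : [|| z == 0, z == 1, z == 2, z == 3 | z == 4] by lia.
  have half_eq2 (c : int) : (c%:~R / 2 == 2 :> R) = (c == 4).
    by rewrite -(eqr_int R); apply/eqP/eqP; lra.
  rewrite !half_eq2.
  by case/or4P => [| | |/orP[]] /eqP -> /=;
    [rewrite ler0_norm|rewrite ler0_norm|rewrite ger0_norm|rewrite ger0_norm|rewrite ger0_norm];
    rewrite ?mulr0n ?mulr1n; lra.
have cE (p : pred 'I_n) : #|p| = (\sum_j p j)%N by rewrite -sum1_card big_mkcond.
have -> : sp2 q v = (\sum_j g (v 0 j) <= q%:R).
  by rewrite /sp2 !cE /g big_split /= -mulr_sumr -!natr_sum.
have -> : \sum_j `|v 0 j - 1| = 2 * \sum_j g (v 0 j).
  rewrite -(eq_bigr _ (fun j _ => gE j)) big_split /=.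
  by rewrite [X in _ + X](reindex_inj rev_ord_inj) /=; under [X in _ + X]eq_bigr do rewrite rev_ordK; ring.
rewrite -[q.*2]mul2n natrM; split; lra.
Qed.

Lemma polytope_sp v : half_integral v -> polytope q v <-> sp1 v /\ sp2 q v.
Proof.
move=> hv; split=> [[v1 v2 v3]|[[v1 v2] /(sp2_sum hv)v3]].
  by split; [split|apply/sp2_sum].
by split=> //; apply: v3; split.
Qed.

Lemma congr_transl_mu x : congr_Waff x (transl (mu m q)) ->
  Sstar x.2 /\ exists2 l, Qvee l & x.1 = mu m q + l.
Proof.
move=> [Q S]; split; first by move: S; rewrite /= invg1 mulg1.
exists (x.1 - mu m q); last by rewrite addrC subrK.
by move: Q; rewrite /= !invg1 !permv1 addrC.
Qed.

Hypothesis qm : (q <= m)%N.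

Lemma sum_mu : \sum_(j : 'I_n | (j < m)%N) (mu m q 0 j - 1) = q%:Z.
Proof.
rewrite (eq_bigr (fun j : 'I_n => if (j < q)%N then 1 else 0)) => [|j jm]; last first.
  by rewrite mxE; repeat (case: ltnP => ?); lia.
rewrite -big_mkcondr /= (eq_bigl (fun j : 'I_n => (j < q)%N)); last by move=> j; lia.
have qn : (q <= n)%N by lia.
by rewrite (big_ord_narrow qn) sumr_const card_ord natz.
Qed.

End SpinConditions.

(** * Comparison of the vertex a_{0'} with a_1 *)

Section VertexOne.
Local Open Scope classical_set_scope.
Local Open Scope ring_scope.
Variables (R : realType) (m : nat) (x : affperm m.*2.+1).
Local Notation n := m.*2.+1.
Implicit Types (j : 'I_n).
Local Notation vtx := (@vtx R m).
Local Notation polytope := (@polytope R m).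

(* The displacements at a_0, a_1 and a_{0'} are x.1, x.1 + e / 2 and x.1 + e. *)
Let e : 'rV[int]_n := permv x.2 (end_row m) - end_row m.

Lemma vtx0 : vtx 0 = 0.
Proof. by apply/rowP => j; rewrite !mxE subn0 ltn_ord. Qed.

Lemma nu0E j : displ x (vtx 0) 0 j = (x.1 0 j)%:~R.
Proof. by rewrite displE vtx0 !mxE subr0 addr0. Qed.

Lemma eE j : e 0 j = end_row m 0 (x.2^-1%g j) - end_row m 0 j.
Proof. by rewrite !mxE. Qed.

Lemma nu0'E j : displ x (vtx 1) 0 j = (x.1 0 j + e 0 j)%:~R.
Proof. have E i : (map_mx intr (end_row m)) 0 i = (end_row m 0 i)%:~R :> R by rewrite mxE.
by rewrite displE vtx1_end !E eE rmorphD rmorphB /= addrA. Qed.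

Lemma end_row_cases j : [\/ j = ord0 /\ end_row m 0 j = -1,
  j = ord_max /\ end_row m 0 j = 1 |
  [/\ j != ord0, j != ord_max & end_row m 0 j = 0]].
Proof.
rewrite mxE; have [->|j0] := eqVneq j ord0; first by constructor 1.
by have [->|j1] := eqVneq j ord_max; [constructor 2|constructor 3].
Qed.

(** The l1-norm is invariant under permutations, so by [half_sum_parity] both rows have half sums of
    the same parity. *)
Lemma sum_perm_parity (b : 'rV[int]_n) s : Sstar s -> skew_row b ->
  (2 %| \sum_(j : 'I_n | (j < m)%N) (permv s b - b) 0%R j)%Z.
Proof.
move=> Ss bN.
have bsN : skew_row (permv s b) by move=> j; rewrite !mxE (Sstar_inv Ss) bN.
have [S1 E1 D1] := half_sum_parity bN.
have [S2 E2 D2] := half_sum_parity bsN.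
have SS : S1 = S2.
  apply: double_inj; rewrite -E1 -E2 (reindex_inj (@perm_inj _ s^-1%g)) /=.
  by apply: eq_bigr => j _; rewrite [in RHS]mxE.
rewrite (eq_bigr (fun j => permv s b 0 j - b 0 j)) => [|j _]; last by rewrite !mxE.
rewrite sumrB; move: D1 D2; rewrite SS.
by move: (\sum_(_ | _) _) (\sum_(_ | _) _) => A B; lia.
Qed.

Hypothesis m_gt0 : (0 < m)%N.

Lemma nu1E j : nu R x 1 0 j = (x.1 0 j)%:~R + (e 0 j)%:~R / 2.
Proof.
rewrite /nu -/(displ x _) displE eE rmorphB /= avec1_end //.
have E i : (2^-1 *: map_mx intr (end_row m)) 0 i = (end_row m 0 i)%:~R / 2 :> R.
  by rewrite mxE mxE mulrC.
by rewrite !E; field.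
Qed.

Lemma nu1_half_integral : half_integral (nu R x 1).
Proof.
move=> j; exists (2 * x.1 0 j + e 0 j).
by rewrite nu1E rmorphD rmorphM /=; field.
Qed.

Lemma nu1_sum : nu R x 1 = 2^-1 *: displ x (vtx 0) + (1 - 2^-1) *: displ x (vtx 1).
Proof.
have scaleE (t : R) (a : 'rV[R]_n) j : (t *: a) 0 j = t * a 0 j by rewrite mxE.
by apply/rowP => j; rewrite [RHS]mxE !scaleE nu1E nu0E nu0'E rmorphD /=; field.
Qed.

Lemma sum_abs_e : (\sum_j absz (e 0%R j) <= 4)%N.
Proof.
have end2 : (\sum_j absz (end_row m 0%R j) = 2)%N.
  rewrite (bigD1 ord0) //= (bigD1 ord_max) /=; last by rewrite eq_sym ord0_neq_max.
  rewrite big1 ?addn0 => [|j /andP[j0 j1]]; last first.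
    by rewrite mxE (negPf j0) (negPf j1).
  by rewrite !mxE eqxx eq_sym ord0_neq_max // eqxx.
apply: (@leq_trans (\sum_j (absz (end_row m 0%R (x.2^-1%g j)) + absz (end_row m 0%R j)))).
  by apply: leq_sum => j _; rewrite eE; lia.
rewrite big_split /=.
have -> : (\sum_j absz (end_row m 0%R (x.2^-1%g j)) = 2)%N.
  by rewrite -end2 [RHS](reindex_inj (@perm_inj _ x.2^-1%g)).
by rewrite end2.
Qed.

Variables (q : nat) (l : 'rV[int]_n).
Hypothesis Sx : Sstar x.2.
Hypotheses (Ql : Qvee l) (xl : x.1 = mu m q + l).

Lemma e_cases j : -1 <= e 0 j <= 1 \/
  (x.2^-1%g ord0 = ord_max /\ (j = ord0 \/ j = ord_max)).
Proof.
rewrite eE; case: (end_row_cases j) => -[j0 j1]; first 2 last.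
- move=> ->; left; case: (end_row_cases (x.2^-1%g j)) => -[_] => [->|->|_ ->] //.
- rewrite j1; case: (end_row_cases (x.2^-1%g j)) => -[s0] => [->|->|_ ->]; try by left.
  by right; split; [rewrite -j0|left].
- rewrite j1; case: (end_row_cases (x.2^-1%g j)) => -[s0] => [->|->|_ ->]; try by left.
  right; split; last by right.
  by rewrite -[ord0]rev_ordK rev_ord0 (Sstar_inv Sx) -j0 s0 rev_ord0.
Qed.

Lemma nu1_polytope : polytope q (displ x (vtx 0)) -> polytope q (displ x (vtx 1)) ->
  polytope q (nu R x 1).
Proof.
move=> P0 P1; rewrite nu1_sum.
by have /convex_setE := @polytope_convex R m q; apply => //; apply/andP; lra.
Qed.

(** The preimage of [ord0] under [x.2] decides. If it is [ord0], then e = 0 and the displacement at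
    a_1 is congruent to mu; if it is an inner index, the entry at [ord0] is not integral. If it is
    [ord_max], the bounds at a_0 and a_{0'} force [x.1 0 ord0 = 0], and the entry is 1. *)
Lemma nu1_sp3 : polytope q (displ x (vtx 0)) -> polytope q (displ x (vtx 1)) ->
  sp3 q 1 (nu R x 1).
Proof.
move=> [_ P0 _] [_ P1 _] int1 ncong; have := int1 ord0.
have /andP[P00 _] := P0 ord0; have /andP[_ P10] := P1 ord0.
move: P00 P10; rewrite nu0E nu0'E nu1E (ler_int R 0) (ler_int R _ 2).
have E : (x.1 0 ord0)%:~R + (e 0 ord0)%:~R / 2 = (2 * x.1 0 ord0 + e 0 ord0)%:~R / 2 :> R.
  by rewrite rmorphD rmorphM /=; field.
rewrite E half_odd_nint => x0 x2 odd0.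
have e0 : end_row m 0 ord0 = -1 by rewrite mxE eqxx.
case: (end_row_cases (x.2^-1%g ord0)) => -[s0]; first 2 last.
- by move=> s1 se; move: odd0; rewrite eE se e0; lia.
- move=> _; case: ncong; exists l => //; apply/rowP => j.
  rewrite nu1E /e (end_row_fix Sx s0) subrr mxE mul0r addr0.
  by rewrite [RHS]mxE xl.
- move=> se; move: x0 x2; rewrite eE se e0 => x0 x2.
  exists ord0 => //; rewrite nu1E eE se e0.
  have -> : x.1 0 ord0 = 0 by lia.
  by lra.
Qed.

Hypothesis qm : (q <= m)%N.

Lemma vtx1_polytope : polytope q (displ x (vtx 0)) -> polytope q (nu R x 1) ->
  sp3 q 1 (nu R x 1) -> polytope q (displ x (vtx 1)).
Proof.
move=> [/sum_const2P s0 b0 _] [/sum_const2P s1 b1 n1] spin.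
have xe_rev j : x.1 0 (rev_ord j) + e 0 (rev_ord j) = 2 - (x.1 0 j + e 0 j).
  apply: (@intr_inj R); rewrite rmorphB rmorphD /= rmorphD /=.
  by have := s0 j; have := s1 j; rewrite !nu0E !nu1E; lra.
split.
- apply/sum_const2P => j; rewrite !nu0'E xe_rev rmorphB /=; ring.
- move=> j; rewrite nu0'E (ler_int R 0) (ler_int R _ 2).
  have : 0 <= x.1 0 j <= 2.
    by rewrite -(ler_int R 0) -(ler_int R _ 2) -nu0E b0.
  have : 0 <= 2 * x.1 0 j + e 0 j <= 4.
    rewrite -(ler_int R 0) -(ler_int R _ 4) rmorphD rmorphM /=.
    by have := b1 j; rewrite nu1E; lra.
  (* When |e_j| <= 1, integrality is enough: by the bounds at a_1, an entry 0 of [x.1] forces e_j >=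
     0 and an entry 2 forces e_j <= 0. *)
  case: (e_cases j) => [|[swap j01]]; first by lia.
  have eN i : e 0 i = - 2 * end_row m 0 i.
    by rewrite /e (end_row_swap m_gt0 Sx swap) !mxE; lia.
  have nuI i : nu R x 1 0 i = (x.1 0 i - end_row m 0 i)%:~R.
    by rewrite nu1E eN rmorphB rmorphM rmorphN /=; field.
  (* The displacement at a_1 is now [x.1 - end_row]. It is not congruent to mu since [end_row] has
     first-half sum -1, so (sp3) provides an entry 1. *)
  have [j' Aj' nuj'] : exists2 j', Aset 1 j' & nu R x 1 0 j' = 1.
    apply: spin => [i|[l' [_ _ Ql'] nul']]; first by rewrite nuI intr_int.
    case: Ql => _ _ Ql0.
    have l'E i : l' 0 i = l 0 i - end_row m 0 i.
      have addE (a b : 'rV[int]_n) : (a + b) 0 i = a 0 i + b 0 i by rewrite mxE.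
      have /rowP/(_ i) := nul'; rewrite nuI [RHS]mxE => /intr_inj.
      by rewrite xl !addE; lia.
    have end1 : \sum_(i : 'I_n | (i < m)%N) end_row m 0 i = -1.
      rewrite (bigD1 ord0) //= big1 => [|i /andP[im i0]].
        by rewrite mxE eqxx.
      rewrite mxE (negPf i0) ifF //; apply/eqP => iE.
      by move: im; rewrite iE /=; lia.
    move: Ql'; rewrite (eq_bigr _ (fun i _ => l'E i)) sumrB end1.
    by move: Ql0; move: (\sum_(_ | _) _) => S; lia.
  (* [Aset 1] consists of the two extreme indices, which are opposite; an entry 1 at one of them
     forces 1 at the other. *)
  have nuj : nu R x 1 0 j = 1.
    have Ej (i : 'I_n) : Aset 1 i -> i = ord0 \/ i = ord_max.
      rewrite /Aset => A; have iN := ltn_ord i.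
      by case: (ltnP i 1) A => i1 /= A; [left|right]; apply: ord_inj => /=; lia.
    have rev_max : rev_ord (ord_max : 'I_n) = ord0 by rewrite -rev_ord0 rev_ordK.
    have := s1 j; case: (Ej _ Aj') j01 => j'E [] jE; rewrite jE ?rev_ord0 ?rev_max;
      by rewrite j'E in nuj'; lra.
  (* So [x.1 0 j] is 1 plus the entry of [end_row], and the displacement at a_{0'} is 1 minus that
     entry. *)
  move: nuj; rewrite nuI eN => /(congr1 (fun r => r - 1)); rewrite subrr -(intrB R _ 1).
  move=> /eqP; rewrite intr_eq0 => /eqP.
  by case: (end_row_cases j) => -[_] => [->|->|_ ->]; lia.
- pose W : 'rV[int]_n := \row_j (x.1 0 j + e 0 j - 1).
  have WN : skew_row W by move=> j; rewrite !mxE; have := xe_rev j; rewrite !mxE; lia.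
  have [S WS WS2] := half_sum_parity WN.
  have -> : \sum_j `|displ x (vtx 1) 0 j - 1| = (S.*2)%:R :> R.
    rewrite -WS natr_sum; apply: eq_bigr => j _.
    by rewrite natr_absz intr_norm nu0'E [W _ _]mxE [in RHS]rmorphB.
  have even_e : (2 %| \sum_(j : 'I_n | (j < m)%N) e 0%R j)%Z.
    by apply: sum_perm_parity => //; exact: end_row_rev.
  (* The first-half sum of [W] is q plus those of [l] and [e]; the former is even by [Qvee], the
     latter by permutation invariance. *)
  have Sq : (2 %| S%:Z - q%:Z)%Z.
    move: WS2; rewrite (eq_bigr (fun j => (mu m q 0 j - 1) + (l 0 j + e 0 j))).
      rewrite big_split /= sum_mu // big_split /=.
      case: Ql => _ _; move: even_e.
      by move: (\sum_(_ | _) _) (\sum_(_ | _) _) => A B; lia.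
    by move=> j _; rewrite [W _ _]mxE xl [(_ + l) _ _]mxE; ring.
  (* [W] is the displacement at a_1 minus 1, plus e/2, and e has l1-norm at most 4. This gives S <=
     q + 1, which parity improves to S <= q. *)
  have : (S.*2)%:R <= (q.*2 + 2)%:R :> R.
    rewrite -WS natr_sum natrD.
    have : \sum_j (absz (e 0%R j))%:R / 2 <= 2 :> R.
      rewrite -mulr_suml -natr_sum; have := sum_abs_e.
      by rewrite -(ler_nat R); lra.
    suff : \sum_j (absz (W 0 j))%:R <= \sum_j `|nu R x 1 0 j - 1| +
        \sum_j (absz (e 0%R j))%:R / 2 :> R by lra.
    rewrite -big_split /=; apply: ler_sum => j _.
    rewrite !natr_absz !intr_norm nu1E [W _ _]mxE !rmorphB rmorphD /=.
    have -> : `|(e 0 j)%:~R| / 2 = `|(e 0 j)%:~R / 2| :> R.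
      by rewrite normrM (@ger0_norm _ 2^-1).
    apply: le_trans (ler_normD _ _).
    by rewrite le_eqVlt; apply/orP; left; apply/eqP; congr (`|_|); field.
  rewrite ler_nat => Sle; rewrite ler_nat; lia.
Qed.

End VertexOne.

(** * Equivalence of the vertex criterion and the spin conditions *)

Section Main.
Local Open Scope classical_set_scope.
Local Open Scope ring_scope.
Variables (R : realType) (m q : nat).
Local Notation n := m.*2.+1.
Hypotheses (m_gt0 : (0 < m)%N) (qm : (q <= m)%N).

Lemma vtx_polytope_spin (I : {set 'I_m.+1}) (x : affperm n) :
  (inord 1 \in I -> ord0 \in I) -> congr_Waff x (transl (mu m q)) ->
  (forall k : 'I_m.+1, k \in I -> polytope q (displ x (vtx R m k))) <->
  spin_permissible_at R q I x.
Proof.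
move=> I10 /congr_transl_mu[Sx [l Ql xl]].
have km (i : 'I_m.+1) : (i <= m)%N by have := ltn_ord i; lia.
have nuE (k : nat) : k != 1%N -> displ x (vtx R m k) = nu R x k.
  by move=> k1; rewrite /vtx (negPf k1).
have hi (k : 'I_m.+1) : k != 1%N :> nat -> half_integral (nu R x k).
  by move=> k1; rewrite -nuE //; apply/displ_half_integral/vtx_half_integral.
have ord01 (k : 'I_m.+1) : k \in I -> k = 1%N :> nat -> ord0 \in I.
  move=> kI k1; apply: I10; rewrite (_ : inord 1 = k) //.
  by apply: ord_inj; rewrite inordK.
split=> [P|[sp12 sp3k] k kI].
  have P01 (k : 'I_m.+1) : k \in I -> k = 1%N :> nat ->
      polytope q (displ x (vtx R m 0)) /\ polytope q (displ x (vtx R m 1)).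
    by move=> kI k1; split; [exact: (P _ (ord01 k kI k1))|rewrite -k1; exact: P].
  split=> k kI.
    have [k1|k1] := eqVneq (k : nat) 1%N.
      have [P0 P1] := P01 k kI k1.
      rewrite k1; apply/polytope_sp; first exact: nu1_half_integral.
      exact: nu1_polytope.
    by apply/polytope_sp; [exact: hi|rewrite -nuE //; exact: P].
  case: (eqVneq (k : nat) 1%N) => [k1 _|k1 k_le1].
    by have [P0 P1] := P01 k kI k1; rewrite k1; apply: (nu1_sp3 m_gt0 Sx Ql xl).
  (* At a_0 = 0 the displacement is the translation part [x.1] itself, which is congruent to mu by
     assumption, so the premise of (sp3) fails. *)
  have k0 : k = 0%N :> nat by lia.
  rewrite k0 => _ []; exists l => //; apply/rowP => j.
  by rewrite -nuE // nu0E xl [RHS]mxE.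
have [k1|k1] := eqVneq (k : nat) 1%N; last first.
  by rewrite nuE //; apply/polytope_sp; [exact: hi|exact: sp12].
have := sp12 k kI; have := sp3k k kI; rewrite k1 => /(_ isT) s3 /polytope_sp.
move=> /(_ (nu1_half_integral R x m_gt0)) P1.
apply: (vtx1_polytope m_gt0 Sx Ql xl qm) => //.
by rewrite nuE //; apply/polytope_sp; [exact: (hi ord0)|exact: (sp12 ord0 (ord01 k kI k1))].
Qed.

End Main.

Theorem proposition9p8p1 (R : realType) (m q : nat)
    (I J : {set 'I_m.+1}) (w : set (affperm m.*2.+1)) :
  (1 <= m)%N -> (q <= m)%N ->
  I != finset.set0 -> J != finset.set0 -> I \subset J ->
  (inord 1 \in I -> ord0 \in I) -> (inord 1 \in J -> ord0 \in J) ->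
  double_coset R J I w ->
  (mu_permissible R q I w <->
     coset_congr q w /\
     exists2 x : affperm m.*2.+1, w x & spin_permissible_at R q I x) /\
  (mu_permissible R q I w <->
     coset_congr q w /\
     forall x : affperm m.*2.+1, w x -> spin_permissible_at R q I x).
Proof.
move=> m_gt0 qm I0 _ IJ I10 J10 [x0 _ wE].
pose P x := forall k : 'I_m.+1, k \in I -> polytope q (displ x (vtx R m k)).
have P_rep x : w x -> P x <-> P x0.
  by rewrite wE => -[u uW [v vW <-]]; exact: double_coset_polytope uW vW.
have wx0 : w x0.
  rewrite wE; exists 1%g; first exact: WI1.
  by exists 1%g; [exact: WI1|rewrite mul1g mulg1].
have mu_permP : mu_permissible R q I w <-> coset_congr q w /\ P x0.
  split=> [[cw [x wx C]]|[cw Px0]]; split=> //.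
    by apply/(P_rep x wx)/FI_Conv_polytope.
  by exists x0 => //; apply/FI_Conv_polytope.
have spinP x : coset_congr q w -> w x -> P x0 <-> spin_permissible_at R q I x.
  by move=> cw wx; rewrite -(P_rep x wx); apply: vtx_polytope_spin => //; exact: cw.
split; rewrite mu_permP; split=> -[cw].
- by move=> Px0; split=> //; exists x0 => //; exact/spinP.
- by move=> [x wx sx]; split=> //; exact/(spinP x).
- by move=> Px0; split=> // x wx; exact/(spinP x).
- by move=> sx; split=> //; apply/(spinP x0) => //; exact: sx.
Qed.
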